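(* Let $\gamma>0$, let $r \ge 2$ be an integer, let $\alpha \in \left( \frac{r-2}{r-1},\frac{r-1}{r} \right]$, and let $H$ be a fixed graph with $m_2^{(r)}(H)>0$. Let $G_\alpha$ be a graph on $n$ vertices with $\delta(G_{\alpha}) \geq \alpha n$, and let $p \ge n^{-1/m_2^{(r)}(H)+\gamma}$. Then asymptotically almost surely the following holds: in the $(1:1)$ Maker-Breaker game played on the edges of $G_{\alpha}\cup G_{n,p}$, Maker has a strategy to claim a copy of $H$.
   Context: For a graph $H'$ on at least $3$ vertices let $d_2(H')=\frac{e(H')-1}{v(H')-2}$, and let $m_2(H)=\max\{d_2(H') : H'\subseteq H,\ v(H')>2\}$ be the maximum $2$-density, with the conventions $m_2(P_1)=1$ for a single edge and $m_2(P_0)=0$ for a single vertex. The $r$-partite $2$-density is $m_2^{(r)}(H)=\min_{V(H)=P_1\cup\dots\cup P_r}\max_i m_2(H[P_i])$, the minimum over all partitions of $V(H)$ into $r$ parts. $G_{n,p}$ is the binomial random graph on the vertex set of $G_\alpha$; $G_\alpha\cup G_{n,p}$ is the union of edge sets. A.a.s. means with probability tending to $1$ as $n\to\infty$. In the $(1:1)$ Maker-Breaker game, the players alternately claim one unclaimed edge each; Maker wins if she claims all edges of a copy of $H$.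
   Formalization: In m_2(H) the single edge (density 1) and single vertex (density 0) count among the subgraphs in the maximum, so a graph of maximum degree 1 has m_2 = 1; with the maximum only over v(H')>2 the claim fails for H = 2K_2 joined to 2K_2, r=2. *)

(* Defs.v *)
From HB Require Import structures.
From mathcomp Require Import all_boot all_order all_algebra.
From mathcomp Require Import all_classical all_reals all_analysis.

Set Implicit Arguments.
Unset Strict Implicit.
Unset Printing Implicit Defensive.

Import Order.TTheory GRing.Theory Num.Theory.
Import numFieldNormedType.Exports.

(** * Finite simple graphs *)

Definition pairs (V : finType) : {set {set V}} := [set e : {set V} | #|e| == 2].

Record sgraph (V : finType) :=
  SGraph { edges : {set {set V}}; edges_pairs : edges \subset pairs V }.

HB.instance Definition _ (V : finType) := [isSub for @edges V].
HB.instance Definition _ (V : finType) := [Finite of sgraph V by <:].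

Section Graphs.
Variable V : finType.
Implicit Types G : sgraph V.

Lemma union_pairs G1 G2 : edges G1 :|: edges G2 \subset pairs V.
Proof. by rewrite finset.subUset !edges_pairs. Qed.

Definition graph_union G1 G2 : sgraph V := SGraph (union_pairs G1 G2).

Definition degree G (v : V) : nat := #|[set e in edges G | v \in e]|.

(* The default value #|V| exceeds every degree, so it matters only if V is
   empty. *)
Definition min_degree G : nat := \big[minn/#|V|]_(v : V) degree G v.

Definition induced_edges G (P : {set V}) : {set {set {x : V | x \in P}}} :=
  [set e : {set {x : V | x \in P}} | [set val x | x in e] \in edges G].

Lemma induced_pairs G (P : {set V}) :
  induced_edges G P \subset pairs {x : V | x \in P}.
Proof.
apply/fintype.subsetP => e; rewrite !inE => /(fintype.subsetP (edges_pairs G)).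
by rewrite inE card_imset //; exact: val_inj.
Qed.

Definition induced_subgraph G (P : {set V}) : sgraph {x : V | x \in P} :=
  SGraph (induced_pairs G P).

End Graphs.

Definition has_copy (W V : finType) (H : sgraph W) (F : {set {set V}}) : Prop :=
  exists f : W -> V, injective f /\
    forall e : {set W}, e \in edges H -> [set f x | x in e] \in F.

(** * Densities *)

Local Open Scope ring_scope.

Section Density.
Variable R : realType.

(* 2-density of a graph with v vertices and e edges.  A graph on at most two
   vertices has e = 1 if it is a single edge and e = 0 otherwise, so the
   second branch is the convention "1 for an edge, 0 for a vertex". *)
Definition d2 (v e : nat) : R :=
  if (2 < v)%N then (e%:R - 1) / (v%:R - 2) else e%:R.

(* The subgraphs of H are the pairs (U, F) of a vertex set U and a set F of
   edges of H inside U.  Those with at most two vertices take part in the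
   maximum with their conventional density, which makes m2 monotone: it is 0
   on edgeless graphs and 1 on graphs with edges and maximum degree 1, where
   the maximum over subgraphs with more than two vertices would be smaller
   than the value on a single edge.  On all other graphs it is that maximum. *)
Definition m2 (W : finType) (H : sgraph W) : R :=
  \big[Num.max/0]_(U : {set W})
    \big[Num.max/0]_(F : {set {set W}} |
        (F \subset edges H) && [forall e in F, e \subset U])
      d2 #|U| #|F|.

(* A partition into r possibly empty parts is a map f to 'I_r, with parts
   f^-1(i).  The default value m2 H is the value of the partition with a
   single nonempty part, so for r > 0 it does not change the minimum. *)
Definition m2r (r : nat) (W : finType) (H : sgraph W) : R :=
  \big[Num.min/m2 H]_(f : {ffun W -> 'I_r})
    \big[Num.max/0]_(i < r) m2 (induced_subgraph H [set x | f x == i]).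

End Density.

(** * The (1:1) Maker-Breaker game on the edges of a graph *)

Section MakerBreaker.
Variable V : finType.
Implicit Types (X : {set {set V}}) (h : seq {set V}).

(* The next edge to claim, given the list of all moves so far, oldest first. *)
Definition strategy := seq {set V} -> {set V}.

Definition legal X (s : strategy) : Prop :=
  forall h, [set:: h] \proper X -> s h \in X :\: [set:: h].

(* Whether move number k (from 0) is Maker's; maker_first says who starts. *)
Definition maker_turn (maker_first : bool) (k : nat) : bool :=
  odd k (+) maker_first.

Fixpoint play (maker_first : bool) (sM sB : strategy) (k : nat) :
    seq {set V} :=
  if k is k'.+1 then
    let h := play maker_first sM sB k' in
    rcons h (if maker_turn maker_first k' then sM h else sB h)
  else [::].

Definition maker_edges (maker_first : bool) h : {set {set V}} :=
  [set:: mask (mkseq (maker_turn maker_first) (size h)) h].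

(* All edges of G have been claimed after #|edges G| moves. *)
Definition maker_wins (maker_first : bool) (W : finType) (H : sgraph W)
    (G : sgraph V) : Prop :=
  exists2 sM : strategy, legal (edges G) sM &
    forall sB : strategy, legal (edges G) sB ->
      has_copy H
        (maker_edges maker_first (play maker_first sM sB #|edges G|)).

End MakerBreaker.

(** * The binomial random graph *)

Section RandomGraph.
Variables (R : realType) (V : finType).

Definition gnp_mass (p : R) (G : sgraph V) : R :=
  \prod_(e in pairs V) (if e \in edges G then p else 1 - p).

Definition gnp_pr (p : R) (A : sgraph V -> Prop) : R :=
  \sum_(G : sgraph V | `[< A G >]) gnp_mass p G.

End RandomGraph.

Definition aas (R : realType) (p : nat -> R)
    (A : forall n : nat, sgraph 'I_n -> Prop) : Prop :=
  ((fun n : nat => gnp_pr (p n) (A n)) @ \oo --> (1 : R))%classic.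

(* Main.v *)
(* Maker plays greedily for the potential
     sum over copies A not yet hit by Breaker of 2^(number of Maker's edges in A).
   In a round where Maker takes x and Breaker takes y the potential drops by at
   most 2^e(H) times the number of copies containing both x and y.  Hence it
   suffices that the total codegree of the pairs played is smaller than the
   number of copies.  Let V(H) = P_1 + ... + P_r be an optimal partition and
   consider the copies whose crossing edges lie in G_alpha and whose k inner
   edges lie in G_{n,p}.  By supersaturation and Chebyshev there are at least
   c n^v(H) p^k of them.  For a vertex set S of H put
   psi(S) = n^|S| p^(number of inner edges in S).  As p exceeds
   n^(-1/m_2^(r)(H)) by a power of n, every S containing two distinct edges of H
   has psi(S) >= n^(2+delta) if both edges cross, and
   psi(S) >= n^(2+delta) p if one of them is inner.  High moments of the number
   of extensions then bound the codegree of two edges by n^v(H) p^k / n^(2+delta'), or by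
   n^v(H) p^k / (n^(2+delta') p) if one of them plays the role of an inner edge
   and so lies in G_{n,p}.  There are at most n^2 rounds of the first kind and
   about n^2 p of the second, so the total codegree is of smaller order than
   the number of copies. *)

From mathcomp Require Import all_boot all_order all_algebra.
From mathcomp Require Import boolp reals exp.
From mathcomp Require Import zify ring lra.
Require Import Defs.

Set Implicit Arguments.
Unset Strict Implicit.
Unset Printing Implicit Defensive.

Import Order.TTheory GRing.Theory Num.Theory.

(** * Greedy Maker *)


Section Potential.
Variables (E I : finType) (P : pred I) (A : I -> {set E}).
Implicit Types (M B : {set E}) (x y : E).

(** An Erdos-Selfridge weight adapted to Maker. The family is indexed, so embeddings with the same
    edge set count separately. *)
Definition pot M B := \sum_(i | P i && [disjoint A i & B]) 2 ^ #|A i :&: M|.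

(** One function measures both Maker's profit at an edge, where the weights through it double, and
    the loss when Breaker takes it, where they vanish. Hence a greedy choice pays for Breaker's
    reply. *)
Definition gain M B x :=
  \sum_(i | [&& P i, [disjoint A i & B] & x \in A i]) 2 ^ #|A i :&: M|.

Definition codeg x y := #|[pred i | [&& P i, x \in A i & y \in A i]]|.

Lemma pot_maker M B x : x \notin M -> pot (x |: M) B = pot M B + gain M B x.
Proof.
move=> xM; rewrite /pot /gain [LHS](bigID (fun i => x \in A i)) /=.
rewrite [in RHS](bigID (fun i => x \in A i)) /= addnAC; congr (_ + _); last first.
  apply: eq_bigr => i /andP[_ xA]; congr (2 ^ #|pred_of_set _|).
  apply/setP => z; rewrite !inE; case: eqP => // ->.
  by rewrite (negbTE xA).
under [X in _ = _ + X]eq_bigl do rewrite andbA.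
rewrite -big_split /=; apply: eq_bigr => i /andP[_ xA].
rewrite setIUr (setIidPr _) ?sub1set // cardsU1 inE (negbTE xM) andbF.
by rewrite expnS mul2n addnn.
Qed.

Lemma pot_breaker M B y : pot M (y |: B) + gain M B y = pot M B.
Proof.
rewrite /pot /gain [RHS](bigID (fun i => y \in A i)) /= addnC; congr (_ + _).
  by apply: eq_bigl => i; rewrite andbA.
apply: eq_bigl => i; rewrite -andbA; congr (_ && _).
by rewrite !disjoints_subset setCU subsetI -disjoints_subset disjoint_sym disjoints1 andbC.
Qed.

(** Only the weights of sets through both [x] and [y] grow, and no weight exceeds [2 ^ s]. *)
Lemma gain_maker s M B x y : (forall i, P i -> #|A i| <= s) -> x \notin M ->
  gain (x |: M) B y <= gain M B y + 2 ^ s * codeg x y.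
Proof.
move=> As xM; rewrite /gain [X in X <= _](bigID (fun i => x \in A i)) /= addnC.
apply: leq_add.
  rewrite [X in _ <= X](bigID (fun i => x \in A i)) /= addnC.
  apply: leq_trans (leq_addr _ _); apply: leq_sum => i /andP[_ xA].
  rewrite leq_exp2l // subset_leq_card //; apply/subsetP => z; rewrite !inE.
  by case: eqP => // ->; rewrite (negbTE xA).
rewrite mulnC /codeg -sum1_card big_distrl /=.
apply: (@leq_trans (\sum_(i | [&& P i, [disjoint A i & B] & y \in A i]
   && (x \in A i)) 2 ^ s)).
  apply: leq_sum => i /andP[/and3P[Pi _ _] _]; rewrite leq_exp2l //.
  by apply: leq_trans (As i Pi); rewrite subset_leq_card // subsetIl.
rewrite [X in _ <= X](bigID (fun i => [disjoint A i & B])) /=.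
apply: leq_trans (leq_addr _ _); rewrite (eq_bigl (fun i =>
  ([&& P i, x \in A i & y \in A i] && [disjoint A i & B]))); last first.
  by move=> i; rewrite -!andbA andbC; do !case: (_ \in _) (P i) => [] []; rewrite ?andbF ?andbT.
by under [X in _ <= X]eq_bigr do rewrite mul1n.
Qed.

(** Bounds the damage of a Breaker move that no Maker move has paid for. *)
Lemma gain_le s M B y : (forall i, P i -> #|A i| <= s) ->
  gain M B y <= 2 ^ s * codeg y y.
Proof.
move=> As; rewrite mulnC /codeg -sum1_card big_distrl /=.
rewrite [X in _ <= X](bigID (fun i => [disjoint A i & B])) /=.
apply: leq_trans (leq_addr _ _); rewrite /gain (eq_bigl (fun i =>
  ([&& P i, y \in A i & y \in A i] && [disjoint A i & B]))); last first.
  by move=> i; rewrite /= andbb -andbA; congr (_ && _); rewrite andbC.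
apply: leq_sum => i /andP[/and3P[Pi _ _] _]; rewrite mul1n leq_exp2l //.
by apply: leq_trans (As i Pi); rewrite subset_leq_card // subsetIl.
Qed.

(* The gain of [x] pays for the loss at [y] except for the sets containing both. *)
Lemma pot_round s M B x y : (forall i, P i -> #|A i| <= s) -> x \notin M ->
    gain M B y <= gain M B x ->
  pot M B <= pot (x |: M) (y |: B) + 2 ^ s * codeg x y.
Proof.
move=> As xM yx; rewrite -(leq_add2r (gain M B x)) -pot_maker //.
rewrite -(pot_breaker (x |: M) B y) -addnA leq_add2l.
apply: leq_trans (gain_maker B y As xM) _.
by rewrite addnC leq_add2l.
Qed.

End Potential.

(** * The greedy strategy and the invariant of a play *)

Section GreedyMaker.
Variables (R : realType) (V I : finType) (P : pred I).
Variable A : I -> {set {set V}}.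
Variables (X : {set {set V}}) (mf : bool).
Implicit Types h : seq {set V}.

Let mk h := maker_edges mf h.
Let bk h := [set:: h] :\: mk h.

Lemma set_rcons h (x : {set V}) : [set:: rcons h x] = x |: [set:: h].
Proof. by apply/setP => z; rewrite !inE mem_rcons inE. Qed.

Lemma maker_edges_rcons h (x : {set V}) : mk (rcons h x) =
  if maker_turn mf (size h) then x |: mk h else mk h.
Proof.
rewrite /mk /maker_edges size_rcons mkseqS mask_rcons ?size_mkseq //.
apply/setP => z; rewrite !inE mem_cat; case: ifP => _ /=.
  by rewrite !inE orbC.
by rewrite inE orbF.
Qed.

Lemma maker_edges_sub h : mk h \subset [set:: h].
Proof. by apply/subsetP => z; rewrite !inE; exact: mem_mask. Qed.

Lemma breaker_edges_rcons h (x : {set V}) : x \notin [set:: h] ->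
  bk (rcons h x) = if maker_turn mf (size h) then bk h else x |: bk h.
Proof.
move=> xh; have xm : x \notin mk h.
  by apply: contra xh; exact: (subsetP (maker_edges_sub h)).
rewrite /bk set_rcons maker_edges_rcons; case: ifP => _; apply/setP => z;
  rewrite !(in_setD, in_setU1); case: eqP => //= ->; rewrite ?(negbTE xh) ?andbF //.
by rewrite xm.
Qed.

(** The default [set0] occurs only when no free edge is left. *)
Definition greedy h : {set V} :=
  if [pick z in X :\: [set:: h]] is Some z0
  then [arg max_(z > z0 in X :\: [set:: h]) gain P A (mk h) (bk h) z]
  else set0.

Lemma greedyP h : [set:: h] \proper X ->
  greedy h \in X :\: [set:: h] /\
  forall z, z \in X :\: [set:: h] ->
    gain P A (mk h) (bk h) z <= gain P A (mk h) (bk h) (greedy h).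
Proof.
move=> /properP[_ [z zX zh]]; rewrite /greedy; case: pickP => [z0 z0P|/(_ z)].
  by case: arg_maxnP.
by rewrite in_setD zX zh.
Qed.

Lemma greedy_legal : legal X greedy.
Proof. by move=> h /greedyP[]. Qed.

Variables (s : nat) (g : {set V} -> R) (D : R).
Hypothesis As : forall i, P i -> #|A i| <= s.
Hypothesis AX : forall i, P i -> A i \subset X.
Hypothesis D_ge0 : (0 <= D)%R.
Hypothesis g_ge0 : forall x, x \in X -> (0 <= g x)%R.
Hypothesis degP : forall y, y \in X -> ((codeg P A y y)%:R <= D)%R.
Hypothesis codegP : forall x y, x \in X -> y \in X -> x != y ->
  ((codeg P A x y)%:R <= g x + g y)%R.
Hypothesis big_family :
  (2 ^+ s * (\sum_(x in X) g x + D) < #|[pred i | P i]|%:R)%R.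

Section Play.
Variable sB : strategy V.
Hypothesis sB_legal : legal X sB.
Let pl k := play mf greedy sB k.

Lemma size_play k : size (pl k) = k.
Proof. by elim: k => //= k IH; rewrite size_rcons -/(pl k) IH. Qed.

Lemma play_proper k : k < #|X| -> [set:: pl k] \subset X ->
  [set:: pl k] \proper X.
Proof.
move=> kX sX; rewrite properEcard sX; apply: leq_ltn_trans kX.
have := card_size (pl k); rewrite size_play; apply: leq_trans.
by apply: subset_leq_card; apply/subsetP => z; rewrite inE.
Qed.

Lemma play_step k : k < #|X| -> [set:: pl k] \subset X ->
  exists2 x, x \in X :\: [set:: pl k] & pl k.+1 = rcons (pl k) x /\
    (maker_turn mf k -> x = greedy (pl k)).
Proof.
move=> kX sX; have pX := play_proper kX sX.
rewrite {2 3}/pl /= -/(pl k); case: ifP => tk.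
  by exists (greedy (pl k)) => //; have [] := greedyP pX.
by exists (sB (pl k)) => //; exact: sB_legal.
Qed.

Lemma play_sub k : k <= #|X| -> [set:: pl k] \subset X /\ #|[set:: pl k]| = k.
Proof.
elim: k => [|k IH] kX.
  by split; [apply/subsetP => z|apply: eq_card0 => z]; rewrite inE.
have [sX cX] := IH (ltnW kX); have [x] := play_step kX sX.
rewrite inE => /andP[xk xX] [-> _]; rewrite set_rcons; split.
  by rewrite subUset sub1set xX.
by rewrite cardsU1 xk cX.
Qed.

Let potk k : R := (pot P A (mk (pl k)) (bk (pl k)))%:R.
Let spent k : R := (\sum_(x in [set:: pl k]) g x)%R.

(** A round loses at most [2 ^ s] times a codegree, which [codegP] splits into charges [g] on its
    two edges. No edge is claimed twice, so the charges add up to at most [spent]; [D] covers an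
    opening move by Breaker. *)
Lemma pot_invariant k : k <= #|X| ->
  (#|[pred i | P i]|%:R <= potk k + 2 ^+ s * (spent k + D))%R.
Proof.
have spS j x : x \notin [set:: pl j] -> pl j.+1 = rcons (pl j) x ->
    spent j.+1 = (g x + spent j)%R.
  by move=> xj e; rewrite /spent e set_rcons big_setU1.
have maker_move j : j.+1 <= #|X| -> maker_turn mf j ->
   (#|[pred i | P i]|%:R <= potk j + 2 ^+ s * (spent j + D))%R ->
   (#|[pred i | P i]|%:R <= potk j.+1 + 2 ^+ s * (spent j.+1 + D))%R.
  move=> jX mj IH; have [sX _] := play_sub (ltnW jX).
  have [x] := play_step jX sX; rewrite inE => /andP[xj xX] [e _].
  apply: le_trans IH _; apply: lerD; last first.
    rewrite ler_pM2l ?exprn_gt0 // lerD2r (spS _ _ xj e) lerDr; exact: g_ge0.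
  rewrite /potk e breaker_edges_rcons // maker_edges_rcons size_play mj ler_nat.
  rewrite pot_maker ?leq_addr //; apply: contra xj.
  exact: (subsetP (maker_edges_sub _)).
have pot0 : potk 0 = (#|[pred i | P i]|%:R)%R.
  rewrite /potk /pot /pl /= -sum1_card; congr (_%:R%R).
  have e : mk [::] = set0.
    by apply/setP => z; rewrite !inE; apply/negP => /mem_mask.
  rewrite /bk e setD0; apply: eq_big => [i|i _]; last by rewrite setI0 cards0.
  rewrite inE [X in _ && X](_ : _ = true) ?andbT //.
  by apply/pred0P => z; rewrite !inE /= andbF.
have spent0 : spent 0 = 0%R.
  by rewrite /spent big1 // => z; rewrite inE.
have h2s : (0 < 2 ^+ s :> R)%R by rewrite exprn_gt0.
(* Induction in steps of two: a Breaker move is paired with the Maker move before it, and only at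
   [k = 1] can a Breaker move lack such a partner. *)
elim/ltn_ind: k => -[|[|k]] IH kX.
- by rewrite pot0 lerDl spent0 add0r mulr_ge0 // ltW.
- have I0 : (#|[pred i | P i]|%:R <= potk 0 + 2 ^+ s * (spent 0 + D))%R.
    by apply: IH.
  case mj : (maker_turn mf 0); first exact: maker_move.
  have [sX _] := play_sub (ltnW kX).
  have [x] := play_step kX sX; rewrite inE => /andP[xj xX] [e _].
  rewrite (spS _ _ xj e) spent0 addr0.
  have -> : (#|[pred i | P i]|%:R = potk 1 +
      (gain P A (mk (pl 0)) (bk (pl 0)) x)%:R :> R)%R.
    rewrite -pot0 /potk e breaker_edges_rcons // maker_edges_rcons size_play mj.
    by rewrite -natrD pot_breaker.
  rewrite lerD2l; apply: (@le_trans _ _ (2 ^ s * codeg P A x x)%N%:R%R).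
    by rewrite ler_nat gain_le.
  rewrite natrM natrX ler_pM2l //; apply: le_trans (degP xX) _.
  by rewrite lerDr g_ge0.
case mj : (maker_turn mf k.+1); first by apply: maker_move => //; apply: IH => //; exact: ltnW.
have mk' : maker_turn mf k.
  by move: mj; rewrite /maker_turn /= addNb => /negbFE.
have kX1 := ltnW kX.
apply: le_trans (IH k _ (ltnW kX1)) _ => //.
have [sX _] := play_sub (ltnW kX1).
have [x] := play_step kX1 sX; rewrite inE => /andP[xj xX] [e /(_ mk') xg].
have [sX' _] := play_sub kX1.
have [y] := play_step kX sX'; rewrite inE => /andP[yj yX] [e' _].
have yj' := yj; rewrite e set_rcons !inE negb_or in yj'.
have /andP[yx yk] := yj'.
have xM : x \notin mk (pl k).
  by apply: contra xj; exact: (subsetP (maker_edges_sub _)).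
rewrite (spS _ _ yj e') (spS _ _ xj e).
have step : (potk k <= potk k.+2 + 2 ^+ s * (codeg P A x y)%:R)%R.
  rewrite /potk e' breaker_edges_rcons // maker_edges_rcons size_play mj.
  rewrite e breaker_edges_rcons // maker_edges_rcons size_play mk'.
  rewrite -natrX -natrM -natrD ler_nat; apply: pot_round => //.
  have [_ H] := greedyP (play_proper (ltnW kX) sX).
  by rewrite xg; apply: H; rewrite !inE yk.
apply: le_trans (lerD step (lexx _)) _.
rewrite -addrA lerD2l -mulrDr ler_pM2l // !addrA !lerD2r (addrC (g y)).
by apply: codegP => //; rewrite eq_sym.
Qed.

(** A positive final potential leaves a set that Breaker has not hit. The whole board is claimed by
    then, so all edges of this set are Maker's. *)
Lemma greedy_wins :
  exists2 i, P i & A i \subset mk (play mf greedy sB #|X|).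
Proof.
have [sX cX] := play_sub (leqnn _).
have plX : [set:: pl #|X|] = X by apply/eqP; rewrite eqEcard sX cX leqnn.
have := pot_invariant (leqnn _); rewrite /spent plX => H.
have : (0 < potk #|X|)%R.
  have := lt_le_trans big_family H.
  by rewrite ltrDr.
rewrite ltr0n lt0n /pot sum_nat_eq0 => /forallPn[i].
rewrite negb_imply => /andP[/andP[Pi dis] _]; exists i => //.
apply/subsetP => z zA; have := subsetP (AX Pi) _ zA; rewrite -{1}plX => zp.
apply/negPn/negP => zm.
have := disjointFr dis zA.
by rewrite /bk in_setD zp -/(pl _) zm.
Qed.

End Play.

End GreedyMaker.

(** * Expectations over the binomial random graph *)


Section Expectation.
Variables (R : realType) (V : finType) (p : R).
Implicit Types (C : {set {set V}}) (Y Z : sgraph V -> R).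
Local Open Scope ring_scope.

Definition Ex Y : R := \sum_(G : sgraph V) gnp_mass p G * Y G.

Lemma Ex_sub C : C \subset pairs V ->
  Ex (fun G => (C \subset edges G)%:R) = p ^+ #|C|.
Proof.
move=> CV.
(* [a] and [b] weigh present and absent edges. Their values 0 and 1 off [pairs V] turn the sum over
   graphs into a sum over all edge sets, and [b] vanishes on [C] to encode the event. The sum then
   factorises over the edges. *)
pose a (e : {set V}) := if e \in pairs V then p else 0.
pose b (e : {set V}) :=
  if e \in pairs V then (if e \in C then 0 else 1 - p) else 1.
pose F (J : {set {set V}}) := \prod_e (if e \in J then a e else b e).
have FG (G : sgraph V) : gnp_mass p G * (C \subset edges G)%:R = F (edges G).
  rewrite /F (bigID (fun e => e \in pairs V)) /= [X in _ = _ * X]big1; last first.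
    move=> e eV; rewrite ifN /b ?(negbTE eV) //.
    by apply: contra eV; exact: (subsetP (edges_pairs G)).
  rewrite mulr1; case: (boolP (C \subset edges G)) => CG.
    rewrite mulr1; apply: eq_bigr => e eV; rewrite /a /b eV.
    case: ifP => // eG; case: ifP => // eC.
    by rewrite (subsetP CG _ eC) in eG.
  have /subsetPn[e eC eG] := CG.
  have eV := subsetP CV _ eC.
  by rewrite mulr0 (bigD1 e) //= (negbTE eG) /b eV eC mul0r.
rewrite /Ex; under eq_bigr do rewrite FG.
transitivity (\sum_(J in {set {set V}}) F J).
  rewrite (bigID (fun J : {set {set V}} => J \subset pairs V)) /= [X in _ = _ + X]big1 ?addr0.
    rewrite (reindex_omap (@edges V) insub) /=; last first.
      by move=> J JV; rewrite insubT.
    apply: eq_bigl => G; rewrite edges_pairs /=.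
    by rewrite (valK G) eqxx.
  move=> J /subsetPn[e eJ eV].
  by rewrite /F (bigD1 e) //= eJ /a (negbTE eV) mul0r.
rewrite -bigA_distr /=.
rewrite (eq_bigr (fun e => if e \in C then p else 1)); last first.
  move=> e _; rewrite /a /b; case: ifPn => eV; case: ifPn => eC.
  - by rewrite addr0.
  - by rewrite addrC subrK.
  - by rewrite (subsetP CV _ eC) in eV.
  - by rewrite add0r.
by rewrite -big_mkcond /= prodr_const.
Qed.

Lemma Ex1 : Ex (fun=> 1) = 1.
Proof.
have := Ex_sub (sub0set (pairs V)); rewrite cards0 expr0; apply: etrans.
by apply: eq_bigr => G _; rewrite sub0set.
Qed.

Lemma ExD Y Z : Ex (fun G => Y G + Z G) = Ex Y + Ex Z.
Proof. by rewrite /Ex -big_split; apply: eq_bigr => G _; rewrite mulrDr. Qed.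

Lemma ExZ c Y : Ex (fun G => c * Y G) = c * Ex Y.
Proof. by rewrite /Ex big_distrr; apply: eq_bigr => G _; rewrite mulrCA. Qed.

Lemma Ex_sum (I : finType) (P : pred I) (Y : I -> sgraph V -> R) :
  Ex (fun G => \sum_(i | P i) Y i G) = \sum_(i | P i) Ex (Y i).
Proof.
rewrite /Ex exchange_big; apply: eq_bigr => G _.
by rewrite big_distrr.
Qed.

Hypothesis p01 : 0 <= p <= 1.

Lemma gnp_mass_ge0 (G : sgraph V) : 0 <= gnp_mass p G.
Proof.
have /andP[p0 p1] := p01.
by apply: prodr_ge0 => e _; case: ifP => // _; rewrite subr_ge0.
Qed.

Lemma Ex_le Y Z : (forall G, Y G <= Z G) -> Ex Y <= Ex Z.
Proof. by move=> YZ; apply: ler_sum => G _; rewrite ler_wpM2l // gnp_mass_ge0. Qed.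

Lemma gnp_pr_le1 (A : sgraph V -> Prop) : gnp_pr p A <= 1.
Proof.
rewrite -Ex1 /Ex /gnp_pr [X in _ <= X](bigID (fun G => `[< A G >])) /=.
under [X in _ <= X + _]eq_bigr do rewrite mulr1.
by rewrite lerDl; apply: sumr_ge0 => G _; rewrite mulr1 gnp_mass_ge0.
Qed.

(** Markov's inequality: outside [A] the variable [Y] is at least 1. *)
Lemma markov_gnp (A : sgraph V -> Prop) Y : (forall G, 0 <= Y G) ->
  (forall G, Y G < 1 -> A G) -> 1 - Ex Y <= gnp_pr p A.
Proof.
move=> Y0 YA; rewrite lerBlDr -Ex1 /gnp_pr.
rewrite {1}/Ex (bigID (fun G => `[< A G >])) /=.
under eq_bigr do rewrite mulr1.
rewrite lerD2l /Ex [X in _ <= X](bigID (fun G => `[< A G >])) /=.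
rewrite -[X in X <= _]add0r lerD //.
  by apply: sumr_ge0 => G _; rewrite mulr_ge0 // gnp_mass_ge0.
apply: ler_sum => G /asboolP nA; rewrite ler_wpM2l ?gnp_mass_ge0 //.
by rewrite leNgt; apply/negP => /YA.
Qed.

End Expectation.

(** * Counting extensions *)


Section Extensions.
Variables (R : realType) (W V : finType) (E0 : {set {set W}}) (p : R).
Hypothesis E0W : E0 \subset pairs W.
Hypothesis p01 : (0 <= p <= 1)%R.
Implicit Types (phi : {ffun W -> V}) (U Q : {set V}) (S T : {set W}).
Implicit Types (C : {set {set V}}).

Definition img phi : {set {set V}} := [set [set phi x | x in e] | e : {set W} in E0].
Definition edges_in S := #|[set e in E0 | e \subset S]|.

Lemma card_img phi : injective phi -> #|img phi| = #|E0|.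
Proof. by move=> phiI; rewrite card_imset //; exact: imset_inj. Qed.

Lemma img_pairs phi : injective phi -> img phi \subset pairs V.
Proof.
move=> phiI; apply/subsetP => _ /imsetP[e /(subsetP E0W) eW ->].
by rewrite !inE card_imset // in eW *.
Qed.

Lemma img_sub phi c : c \in img phi -> c \subset [set phi x | x in W].
Proof.
by case/imsetP => e _ ->; apply/subsetP => _ /imsetP[x _ ->]; exact: imset_f.
Qed.

(** An edge of [E0] not inside the preimage of [U] has an image not inside [U], hence not in [C]. *)
Lemma card_setU_img phi C U : injective phi -> {in C, forall c : {set V}, c \subset U} ->
  #|C| + (#|E0| - edges_in (phi @^-1: U)) <= #|C :|: img phi|.
Proof.
move=> phiI CU; set S := phi @^-1: U.
pose E1 := [set e in E0 | ~~ (e \subset S)].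
have cE1 : #|E0| - edges_in S = #|[set [set phi x | x in e] | e : {set W} in E1]|.
  rewrite card_imset; last exact: imset_inj.
  rewrite -(cardsID [set e : {set W} | e \subset S] E0) /edges_in.
  rewrite (_ : E0 :&: _ = [set e in E0 | e \subset S]); last first.
    by apply/setP => e; rewrite !inE.
  rewrite addKn; congr #|pred_of_set _|.
  by apply/setP => e; rewrite !inE andbC.
have dis : C :&: [set [set phi x | x in e] | e : {set W} in E1] = set0.
  apply/setP => c; rewrite !inE; apply/negP => /andP[cC /imsetP[e]].
  rewrite inE => /andP[_ /subsetPn[x xe xS]] ce.
  move/negP: xS; apply; rewrite inE; apply: (subsetP (CU _ cC)).
  by rewrite ce imset_f.
rewrite cE1 -[X in X <= _]subn0 -(cards0 {set V}) -dis -cardsU.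
apply: subset_leq_card; apply: setUS; apply: imsetS.
by apply/subsetP => e; rewrite inE => /andP[].
Qed.

Lemma card_preim_eq U S :
  #|[pred phi : {ffun W -> V} | phi @^-1: U == S]| <= #|U| ^ #|S| * #|V| ^ (#|W| - #|S|).
Proof.
pose F (w : W) : pred V := fun v => (w \in S) ==> (v \in U).
apply: (@leq_trans #|family F|).
  apply: subset_leq_card; apply/subsetP => phi; rewrite inE => /eqP phiS.
  by apply/familyP => w; rewrite /F -phiS unfold_in inE; apply/implyP.
rewrite card_family foldrE big_map big_enum /= (bigID (mem S)) /=.
have -> : #|W| - #|S| = #|~: S| by rewrite [RHS]cardsCs setCK.
rewrite -!prod_nat_const.
apply/eq_leq; congr (_ * _).
  by apply: eq_bigr => w wS; apply: eq_card => v; rewrite /F unfold_in wS.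
apply: eq_big => [w|w wS]; first by rewrite inE.
by apply: eq_card => v; rewrite /F unfold_in (negbTE wS) inE.
Qed.

Local Open Scope ring_scope.

(** Bounds the expected number of embeddings that send [T] into a set [U] of [u] vertices when edges
    inside [U] may already be present: [S] is the preimage of [U], and only edges not inside [S]
    cost a factor [p]. *)
Definition ext_count (u : nat) T : R := \sum_(S : {set W} | T \subset S)
  (u ^ #|S|)%:R * #|V|%:R ^+ (#|W| - #|S|) * p ^+ (#|E0| - edges_in S).

Lemma ext_count_ge0 u T : 0 <= ext_count u T.
Proof.
have /andP[p0 _] := p01.
by apply: sumr_ge0 => S _; rewrite !mulr_ge0 ?exprn_ge0.
Qed.

Lemma ext_count_le u u' T : (u <= u')%N -> ext_count u T <= ext_count u' T.
Proof.
have /andP[p0 _] := p01.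
move=> uu; apply: ler_sum => S _; rewrite !ler_wpM2r ?exprn_ge0 //.
by rewrite ler_nat; elim: #|S| => // n IH; rewrite !expnS leq_mul.
Qed.

(* [S] is the set of vertices mapped into [U]: edges not inside [S] are new. *)
Lemma ext_sum C U T : {in C, forall c : {set V}, c \subset U} ->
  \sum_(phi : {ffun W -> V} | injectiveb phi && ([set phi x | x in T] \subset U))
     p ^+ #|C :|: img phi| <= p ^+ #|C| * ext_count #|U| T.
Proof.
have /andP[p0 p1] := p01.
move=> CU; rewrite (partition_big (fun phi : {ffun W -> V} => phi @^-1: U)
  (fun S : {set W} => T \subset S)) /=; last first.
  move=> phi /andP[_ TU]; apply/subsetP => x xT; rewrite inE.
  by apply: (subsetP TU); exact: imset_f.
rewrite /ext_count big_distrr; apply: ler_sum => S TS /=.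
apply: (@le_trans _ _ (\sum_(phi : {ffun W -> V} | phi @^-1: U == S)
    p ^+ (#|C| + (#|E0| - edges_in S)))).
  rewrite [X in _ <= X](bigID (fun phi : {ffun W -> V} =>
    injectiveb phi && ([set phi x | x in T] \subset U))) /=.
  rewrite -[X in X <= _]addr0 lerD //; last first.
    by apply: sumr_ge0 => *; rewrite exprn_ge0.
  rewrite (eq_bigl (fun phi : {ffun W -> V} => (phi @^-1: U == S) &&
    (injectiveb phi && ([set phi x | x in T] \subset U)))); last first.
    by move=> phi; rewrite andbC.
  apply: ler_sum => phi /andP[/eqP phiS /andP[/injectiveP phiI _]].
  by rewrite ler_wiXn2l // -phiS card_setU_img.
rewrite sumr_const exprD -[X in X <= _]mulr_natr -[X in X <= _]mulrA.
rewrite ler_wpM2l ?exprn_ge0 //.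
rewrite mulrC ler_wpM2r ?exprn_ge0 // -natrX -natrM ler_nat.
apply: leq_trans (card_preim_eq U S); apply: eq_leq.
by apply: eq_card => phi.
Qed.

(** The values on [T] are confined to [Q] but not prescribed, so one count covers all orientations
    of the edges spanning [T]. *)
Definition rooted Q T (G : sgraph V) : nat :=
  #|[pred phi : {ffun W -> V} | [&& injectiveb phi, [set phi x | x in T] \subset Q
                  & img phi \subset edges G]]|.

(* Expanding one factor of the power replaces [C] by [C :|: img phi] and enlarges
   [U] by the image of [phi]; the event [C \subset edges G] carries the induction. *)
Lemma moment_rooted T Q j : forall C U u, C \subset pairs V ->
  {in C, forall c : {set V}, c \subset U} -> Q \subset U -> (#|U| + j * #|W| <= u)%N ->
  Ex p (fun G => (C \subset edges G)%:R * (rooted Q T G)%:R ^+ j) <=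
    p ^+ #|C| * ext_count u T ^+ j.
Proof.
have /andP[p0 p1] := p01.
elim: j => [|j IH] C U u CV CU QU uU.
  rewrite expr0 mulr1 -Ex_sub //; apply: Ex_le => // G.
  by rewrite expr0 mulr1.
have -> : Ex p (fun G => (C \subset edges G)%:R * (rooted Q T G)%:R ^+ j.+1) =
  \sum_(phi : {ffun W -> V} | injectiveb phi && ([set phi x | x in T] \subset Q))
    Ex p (fun G => (C :|: img phi \subset edges G)%:R * (rooted Q T G)%:R ^+ j).
  rewrite -Ex_sum; apply: eq_bigr => G _; congr (_ * _).
  rewrite -big_distrl exprS mulrA /=; congr (_ * _).
  rewrite /rooted -sum1_card natr_sum big_distrr /=.
  rewrite (eq_bigl (fun phi : {ffun W -> V} => (injectiveb phi && ([set phi x | x in T] \subset Q))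
     && (img phi \subset edges G))); last by move=> phi; rewrite inE andbA.
  rewrite big_mkcondr; apply: eq_bigr => phi _; rewrite subUset.
  by case: (C \subset _); case: (img phi \subset _); rewrite ?mulr1 ?mul0r.
apply: (@le_trans _ _ (\sum_(phi : {ffun W -> V} | injectiveb phi &&
    ([set phi x | x in T] \subset Q)) p ^+ #|C :|: img phi| * ext_count u T ^+ j)).
  apply: ler_sum => phi /andP[/injectiveP phiI _].
  apply: (IH _ (U :|: [set phi x | x in W])).
  - by rewrite subUset CV img_pairs.
  - move=> c; rewrite inE => /orP[/CU cU|/img_sub cU].
      by rewrite subsetU // cU.
    by rewrite subsetU // cU orbT.
  - by rewrite subsetU // QU.
  - apply: leq_trans uU; rewrite mulSn addnA leq_add2r.
    apply: leq_trans (leq_card_setU _ _) _.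
    by rewrite leq_add2l leq_imset_card.
rewrite -big_distrl exprS mulrA ler_wpM2r ?exprn_ge0 ?ext_count_ge0 //.
apply: le_trans (_ : p ^+ #|C| * ext_count #|U| T <= _); last first.
  rewrite ler_wpM2l ?exprn_ge0 // ext_count_le //.
  by apply: leq_trans uU; rewrite leq_addr.
apply: le_trans (ext_sum T CU).
rewrite [X in _ <= X](bigID (fun phi : {ffun W -> V} => [set phi x | x in T] \subset Q)) /=.
rewrite -[X in X <= _]addr0 lerD //; last first.
  by apply: sumr_ge0 => *; rewrite exprn_ge0.
rewrite le_eqVlt; apply/orP; left; apply/eqP; apply: eq_bigl => phi.
case: (injectiveb phi) => //=; apply/idP/andP => [TQ|[]//].
by split=> //; apply: subset_trans QU.
Qed.

(** * Second moment of the number of surviving maps *)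

Section SecondMoment.
Variable D : pred {ffun W -> V}.
Hypothesis D_inj : forall phi, D phi -> injective phi.

Definition surviving (G : sgraph V) : nat :=
  #|[pred phi : {ffun W -> V} | D phi && (img phi \subset edges G)]|.

Let mu : R := #|[pred phi : {ffun W -> V} | D phi]|%:R * p ^+ #|E0|.

Let survivingE G : (surviving G)%:R =
  \sum_(phi : {ffun W -> V} | D phi) (img phi \subset edges G)%:R :> R.
Proof.
rewrite /surviving -sum1_card natr_sum big_mkcondr.
by apply: eq_bigr => phi _; case: (_ \subset _).
Qed.

Lemma Ex_surviving : Ex p (fun G => (surviving G)%:R) = mu.
Proof.
transitivity (Ex p (fun G => \sum_(phi : {ffun W -> V} | D phi) (img phi \subset edges G)%:R)).
  by apply: eq_bigr => G _; rewrite survivingE.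
rewrite Ex_sum (eq_bigr (fun=> p ^+ #|E0|)) => [|phi /D_inj phiI].
  by rewrite sumr_const /mu mulr_natl.
by rewrite Ex_sub ?card_img ?img_pairs.
Qed.

(** Pairs with edge-disjoint images are absorbed by [mu ^+ 2]. Otherwise [psi] sends some [e] of
    [E0] into the vertex set of the image of [phi], and [ext_sum] with root set [e] bounds these
    pairs. *)
Lemma variance_surviving :
  Ex p (fun G => ((surviving G)%:R - mu) ^+ 2) <=
    mu * \sum_(e in E0) ext_count #|W| e.
Proof.
have /andP[p0 p1] := p01.
have -> : Ex p (fun G => ((surviving G)%:R - mu) ^+ 2) =
   Ex p (fun G => (surviving G)%:R ^+ 2) - mu ^+ 2.
  transitivity (Ex p (fun G : sgraph V => (surviving G)%:R ^+ 2 +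
     ((- 2 * mu) * (surviving G)%:R + mu ^+ 2 * 1))).
    by apply: eq_bigr => G _; congr (_ * _); ring.
  by rewrite ExD ExD !ExZ Ex_surviving Ex1; ring.
rewrite lerBlDr.
have -> : Ex p (fun G => (surviving G)%:R ^+ 2) =
  \sum_(phi : {ffun W -> V} | D phi) \sum_(psi : {ffun W -> V} | D psi) p ^+ #|img phi :|: img psi|.
  transitivity (Ex p (fun G => \sum_(phi : {ffun W -> V} | D phi) \sum_(psi : {ffun W -> V} | D psi)
     (img phi :|: img psi \subset edges G)%:R)).
    apply: eq_bigr => G _; congr (_ * _).
    rewrite survivingE expr2 big_distrl; apply: eq_bigr => phi _ /=.
    rewrite big_distrr; apply: eq_bigr => psi _ /=.
    by rewrite subUset; case: (_ \subset _); rewrite /= ?mul1r ?mul0r.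
  rewrite Ex_sum; apply: eq_bigr => phi /D_inj phiI.
  rewrite Ex_sum; apply: eq_bigr => psi /D_inj psiI.
  by rewrite Ex_sub // subUset !img_pairs.
have -> : mu * (\sum_(e in E0) ext_count #|W| e) + mu ^+ 2 =
  \sum_(phi : {ffun W -> V} | D phi) (p ^+ #|E0| * (\sum_(e in E0) ext_count #|W| e) +
    \sum_(psi : {ffun W -> V} | D psi) p ^+ #|E0| * p ^+ #|E0|).
  rewrite !sumr_const -[RHS]mulr_natr -[X in _ = (_ + X) * _]mulr_natr.
  by rewrite /mu; move: (_%:R) (p ^+ _) (\sum_(e in E0) _) => K q S; ring.
apply: ler_sum => phi /D_inj phiI.
set U := [set phi x | x in W].
have UW : (#|U| <= #|W|)%N by exact: leq_imset_card.
apply: (@le_trans _ _ (\sum_(psi : {ffun W -> V} | D psi) ((\sum_(e in E0)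
    if [set psi x | x in e] \subset U then p ^+ #|img phi :|: img psi| else 0)
    + p ^+ #|E0| * p ^+ #|E0|))).
  apply: ler_sum => psi /D_inj psiI.
  have [dis|] := boolP [disjoint img phi & img psi].
    rewrite cardsU (_ : img phi :&: img psi = set0) ?cards0 ?subn0; last first.
      by apply/eqP; rewrite setI_eq0.
    rewrite !card_img // exprD lerDr; apply: sumr_ge0 => e _.
    by case: ifP => // _; rewrite ?mulr_ge0 ?exprn_ge0.
  move=> /pred0Pn[c /= /andP[c1 /imsetP[e eE ce]]].
  apply: ler_wpDr; first by rewrite mulr_ge0 ?exprn_ge0.
  rewrite (bigD1 e) //= -ce img_sub // lerDl.
  by apply: sumr_ge0 => e' _; case: ifP => // _; rewrite exprn_ge0.
rewrite big_split lerD2r exchange_big big_distrr /=.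
apply: ler_sum => e _; rewrite -(card_img phiI).
apply: le_trans (_ : _ <= p ^+ #|img phi| * ext_count #|U| e) _; last first.
  by rewrite ler_wpM2l ?exprn_ge0 // ext_count_le.
apply: le_trans (ext_sum e (@img_sub phi)).
rewrite -big_mkcondr /= [X in _ <= X](bigID D) /=.
rewrite -[X in X <= _]addr0 lerD //; last first.
  by apply: sumr_ge0 => *; rewrite exprn_ge0.
rewrite le_eqVlt; apply/orP; left; apply/eqP; apply: eq_bigl => psi.
case: (boolP (D psi)) => [/D_inj psiI|_]; last by rewrite andbF.
by rewrite andbT; have /injectiveP -> := psiI.
Qed.

End SecondMoment.

End Extensions.

(** * Supersaturation *)


(** Cauchy-Schwarz, obtained by summing [2 * (F i * F j) <= F i ^ 2 + F j ^ 2] over all pairs. *)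
Lemma sqr_sum_le (I : finType) (F : I -> nat) :
  (\sum_i F i) ^ 2 <= #|I| * \sum_i F i ^ 2.
Proof.
rewrite -(leq_pmul2l (isT : 0 < 2)) -mulnn big_distrlr big_distrr /=.
have -> : 2 * (#|I| * \sum_i F i ^ 2) = \sum_i \sum_j (F i ^ 2 + F j ^ 2).
  rewrite [RHS](eq_bigr (fun i => #|I| * F i ^ 2 + \sum_j F j ^ 2)) => [|i _].
    by rewrite big_split /= sum_nat_const -big_distrr /= mul2n addnn.
  by rewrite big_split /= sum_nat_const.
apply: leq_sum => i _; rewrite big_distrr /=; apply: leq_sum => j _.
exact: nat_Cauchy.
Qed.

Section Slots.
Variables (V T : finType) (C : eqType) (col : T -> C) (adj : rel V).
Hypothesis adj_sym : symmetric adj.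
Implicit Types (A : {set T}) (psi : {ffun T -> V}).

Definition upd psi t z : {ffun T -> V} := [ffun x => if x == t then z else psi x].

(** Exchanging [z] with the old value at [t] is an involution on the pairs [(psi, z)]. *)
Lemma sum_upd (F : {ffun T -> V} -> nat) t :
  \sum_psi \sum_z F (upd psi t z) = #|V| * \sum_psi F psi.
Proof.
rewrite pair_big /=.
pose swap (u : {ffun T -> V} * V) := (upd u.1 t u.2, u.1 t).
have swapK : involutive swap.
  move=> [psi z]; rewrite /swap /= ffunE eqxx; congr (_, _).
  by apply/ffunP => x; rewrite !ffunE; case: eqP => // ->.
rewrite (reindex_inj (inv_inj swapK)) /=.
rewrite (eq_bigr (fun u => F u.1)) => [|u _]; last by have := swapK u; case: u => psi z [-> _].
rewrite -(pair_big xpredT xpredT (fun psi _ => F psi)) /= exchange_big /=.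
by rewrite sum_nat_const.
Qed.

Definition good A psi :=
  [forall s in A, forall t in A, (col s != col t) ==> adj (psi s) (psi t)].

Lemma goodP A psi : reflect
  {in A &, forall s t, col s != col t -> adj (psi s) (psi t)} (good A psi).
Proof.
apply: (iffP forall_inP) => [H s t sA tA st|H s sA].
  by have /forall_inP/(_ t tA)/implyP := H s sA; apply.
by apply/forall_inP => t tA; apply/implyP; exact: H.
Qed.

Definition num_good A := \sum_psi good A psi.

(* Gluing two good maps that differ only at [t0] gives a good map of the graph
   in which [t0] has been duplicated; Cauchy-Schwarz counts such pairs. *)
Lemma num_good_dup A t0 t1 : t0 \in A -> t1 \notin A -> col t0 = col t1 ->
  num_good A ^ 2 <= #|{ffun T -> V}| * num_good (t1 |: A).
Proof.
move=> t0A t1A ct.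
have t10 : t1 != t0 by apply: contraNneq t1A => ->.
have [V0|V0] := posnP #|V|.
  by rewrite /num_good big1 // => psi _; have := card0_eq V0 (psi t0).
rewrite -(leq_pmul2l (_ : 0 < #|V| ^ 2)) ?expn_gt0 ?V0 // -expnMn.
rewrite /num_good -(sum_upd _ t0); apply: leq_trans (sqr_sum_le _) _.
rewrite mulnCA leq_mul2l; apply/orP; right.
have -> : #|V| ^ 2 * \sum_psi good (t1 |: A) psi =
    \sum_psi \sum_z' \sum_z good (t1 |: A) (upd (upd psi t1 z') t0 z).
  by rewrite (sum_upd (fun psi => \sum_z (good (t1 |: A) (upd psi t0 z) : nat)))
    (sum_upd (fun psi => good (t1 |: A) psi)) mulnA.
apply: leq_sum => psi _; rewrite -mulnn big_distrlr /= exchange_big.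
apply: leq_sum => z' _; apply: leq_sum => z _; rewrite mulnb.
(* Both [z] and [z'] are good values at [t0] over the same [psi]. Putting [z'] at [t1] is safe: [t0]
   and [t1] share a colour, so no edge between them is required. *)
case: andP => // -[/goodP g1 /goodP g2]; rewrite lt0b; apply/goodP.
have e1 s : s \in A -> upd (upd psi t1 z') t0 z s = upd psi t0 z s.
  by move=> sA; rewrite !ffunE; case: (s == t0) => //; case: eqP => // e; rewrite -e sA in t1A.
have e2 t : t \in A -> col t1 != col t -> adj z' (psi t).
  move=> tA; rewrite -ct => c; have := g2 t0 t t0A tA c.
  by rewrite !ffunE eqxx ifN //; apply: contraNneq c => ->.
have e3 t : col t1 != col t -> upd (upd psi t1 z') t0 z t = psi t.
  by move=> c; rewrite !ffunE !ifN //; apply: contraNneq c => ->; rewrite ?ct.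
have e4 : upd (upd psi t1 z') t0 z t1 = z' by rewrite !ffunE (negbTE t10) eqxx.
move=> s t; rewrite !inE => /orP[/eqP->|sA] /orP[/eqP->|tA] c.
- by rewrite eqxx in c.
- by rewrite e4 e3 ?e2.
- by rewrite adj_sym e4 e3 1?eq_sym // e2 // eq_sym.
- by rewrite !e1 //; apply: g1.
Qed.

(** Union bound: each slot of [A] forbids at most [b] values at [t1]. *)
Lemma num_good_ext A t1 b : t1 \notin A ->
    (forall v, #|[pred z | ~~ adj v z]| <= b) ->
  (#|V| - #|A| * b) * num_good A <= #|V| * num_good (t1 |: A).
Proof.
move=> t1A adjb; rewrite /num_good -(sum_upd (fun psi => good (t1 |: A) psi) t1).
rewrite big_distrr; apply: leq_sum => psi _ /=.
case: goodP => [gA|_]; last by rewrite muln0.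
rewrite muln1 leq_subLR.
apply: (@leq_trans (\sum_z (\sum_(s in A) ~~ adj (psi s) z + good (t1 |: A) (upd psi t1 z)))).
  rewrite -sum1_card; apply: leq_sum => z _.
  case: (boolP [exists s in A, ~~ adj (psi s) z]) => [/exists_inP[s sA nz]|].
    by rewrite (bigD1 s) //= nz -addnA leq_addr.
  rewrite negb_exists_in => /forall_inP H; apply: ltn_addl; rewrite lt0b.
  have e0 s : s \in A -> upd psi t1 z s = psi s.
    by move=> sA; rewrite ffunE ifN //; apply: contraNneq t1A => <-.
  have e1 : upd psi t1 z t1 = z by rewrite ffunE eqxx.
  apply/goodP => s t; rewrite !inE => /orP[/eqP->|sA] /orP[/eqP->|tA] c.
  - by rewrite eqxx in c.
  - by rewrite e1 e0 // adj_sym; apply/negPn/H.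
  - by rewrite e1 e0 //; apply/negPn/H.
  - by rewrite !e0 //; apply: gA.
rewrite big_split leq_add2r /= exchange_big /= -sum_nat_const.
apply: leq_sum => s sA; rewrite -big_mkcond /= sum1_card; exact: adjb.
Qed.

Lemma card_collision t0 t1 : t0 != t1 ->
  #|V| * #|[pred psi : {ffun T -> V} | psi t0 == psi t1]| = #|{ffun T -> V}|.
Proof.
rewrite eq_sym => /negbTE t10.
have -> : #|[pred psi : {ffun T -> V} | psi t0 == psi t1]| =
    \sum_(psi : {ffun T -> V}) (psi t0 == psi t1).
  rewrite -sum1_card big_mkcond; apply: eq_bigr => psi _.
  by rewrite inE; case: (_ == _).
rewrite -(sum_upd (fun psi => psi t0 == psi t1) t0) -sum1_card.
apply: eq_bigr => psi _; rewrite (bigD1 (psi t1)) //= !ffunE eqxx.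
rewrite t10 eqxx big1 // => z zt.
by rewrite !ffunE eqxx t10 (negbTE zt).
Qed.

End Slots.

Section Supersaturation.
Variables (R : realType) (r : nat) (W : finType) (f : W -> 'I_r).
Local Open Scope ring_scope.

(* Slots: one representative vertex per part, followed by the vertices of [W]. *)
Let col (t : 'I_r + W) : 'I_r := match t with inl i => i | inr w => f w end.

Section Fixed.
Variables (V : finType) (adj : rel V) (b : nat) (delta : R).
Hypothesis adj_sym : symmetric adj.
Hypothesis adjb : forall v, (#|[pred z | ~~ adj v z]| <= b)%N.
Hypothesis delta_gt0 : 0 < delta.
Hypothesis delta_b : delta * #|V|%:R <= #|V|%:R - r.-1%:R * b%:R.
Hypothesis V_gt0 : (0 < #|V|)%N.

Let N : R := #|{ffun ('I_r + W)%type -> V}|%:R.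

(** Representatives are chosen one at a time. At most [r - 1] precede each of them, so [delta_b]
    leaves at least [delta * #|V|] values. *)
Lemma num_good_clique (l : seq 'I_r) : uniq l ->
  delta ^+ size l * N <= (num_good col adj [set inl i | i in l])%:R.
Proof.
elim: l => [|i l IH] /=.
  move=> _; rewrite mul1r /N ler_nat -sum1_card; apply: leq_sum => psi _.
  rewrite lt0b; apply/goodP => s t; by case/imsetP.
move=> /andP[il ul].
have -> : [set inl j | j in i :: l] = (inl i : 'I_r + W) |: [set inl j | j in l].
  apply/setP => t; rewrite !inE; apply/imsetP/orP.
    move=> [j]; rewrite inE => /orP[/eqP->|jl] ->; [by left|right].
    exact: imset_f.
  move=> [/eqP->|/imsetP[j jl ->]]; first by exists i; rewrite // inE eqxx.
  by exists j; rewrite // inE jl orbT.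
set A := [set inl j | j in l].
have iA : (inl i : 'I_r + W) \notin A.
  by apply: contra il => /imsetP[j jl [->]].
have cA : (#|A| <= r.-1)%N.
  rewrite /A card_imset; last by move=> ? ? [].
  have : (size (i :: l) <= #|'I_r|)%N.
    by rewrite -(card_uniqP _) /= ?il // max_card.
  rewrite card_ord /= (card_uniqP ul) => H.
  by move: (size l) H => m; case: (r).
have H := num_good_ext col adj_sym iA adjb.
have V0 : 0 < #|V|%:R :> R by rewrite ltr0n.
rewrite -(ler_pM2l V0) -natrM.
apply: (@le_trans _ _ ((#|V| - #|A| * b) * num_good col adj A)%N%:R); last first.
  by rewrite ler_nat.
apply: (@le_trans _ _ ((delta * #|V|%:R) * (num_good col adj A)%:R)).
  have -> : #|V|%:R * (delta ^+ (size l).+1 * N) =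
      (delta * #|V|%:R) * (delta ^+ size l * N) by rewrite exprS; ring.
  by rewrite ler_pM2l ?IH // mulr_gt0.
rewrite natrM ler_wpM2r //; apply: le_trans delta_b _.
apply: (@le_trans _ _ (#|V|%:R - (#|A| * b)%N%:R)).
  by rewrite lerD2l lerN2 -natrM ler_nat leq_mul2r cA orbT.
by rewrite lerBlDr -natrD ler_nat; lia.
Qed.

(** A vertex of [W] enters as a duplicate of the representative of its part, and each duplication
    squares the lower bound on the density. *)
Lemma num_good_blowup (l : seq W) : uniq l ->
  (delta ^+ r) ^+ (2 ^ size l) * N <=
  (num_good col adj ([set inl i | i : 'I_r] :|: [set inr w | w in l]))%:R.
Proof.
elim: l => [|w l IH] /=.
  move=> _; rewrite expr1.
  have -> : [set inl i | i : 'I_r] :|: [set inr w | w in [::]] =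
     [set inl i | i in enum 'I_r] :> {set 'I_r + W}.
    rewrite (_ : [set inr w | w in [::]] = set0) ?setU0.
      by apply/setP => t; apply/imsetP/imsetP => -[i _ ->]; exists i; rewrite ?inE ?mem_enum.
    by apply/setP => t; rewrite inE; apply/imsetP => -[].
  by have := num_good_clique (enum_uniq 'I_r); rewrite size_enum_ord.
move=> /andP[wl ul].
set A := [set inl i | i : 'I_r] :|: [set inr w | w in l].
have -> : [set inl i | i : 'I_r] :|: [set inr w | w in w :: l] = (inr w : 'I_r + W) |: A.
  rewrite setUCA; congr (_ :|: _).
  apply/setP => t; rewrite !inE; apply/imsetP/orP.
    move=> [j]; rewrite inE => /orP[/eqP->|jl] ->; [by left|right].
    exact: imset_f.
  move=> [/eqP->|/imsetP[j jl ->]]; first by exists w; rewrite // inE eqxx.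
  by exists j; rewrite // inE jl orbT.
have wA : (inr w : 'I_r + W) \notin A.
  rewrite inE negb_or; apply/andP; split; first by apply/imsetP => -[].
  by apply: contra wl => /imsetP[j jl [->]].
have fA : (inl (f w) : 'I_r + W) \in A by rewrite inE imset_f.
have H := num_good_dup adj_sym fA wA (erefl _ : col (inl (f w)) = col (inr w)).
have N0 : 0 < N.
  by rewrite /N ltr0n card_ffun expn_gt0 V_gt0.
rewrite -(ler_pM2l N0) expnS mulnC exprM.
apply: (@le_trans _ _ ((num_good col adj A)%:R ^+ 2)).
  rewrite mulrC -mulrA -expr2 -exprMn lerXn2r ?nnegrE ?IH //.
  by rewrite mulr_ge0 ?exprn_ge0 // ltW.
by rewrite -natrX -natrM ler_nat.
Qed.

(** Forgets the representatives, which take at most [#|V| ^ r] values for each map on [W]. *)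
Lemma num_crossing_maps :
  (delta ^+ r) ^+ (2 ^ #|W|) * #|V|%:R ^+ #|W| <=
  #|[pred phi : {ffun W -> V} |
     [forall a, forall b, (f a != f b) ==> adj (phi a) (phi b)]]|%:R.
Proof.
set D := [pred phi | _].
have := num_good_blowup (enum_uniq W); rewrite -cardE.
set A := _ :|: _.
have -> : A = setT.
  apply/setP => -[i|w]; rewrite !inE; first by rewrite imset_f.
  by rewrite orbC imset_f // mem_enum.
pose split (psi : {ffun ('I_r + W)%type -> V}) : {ffun 'I_r -> V} * {ffun W -> V} :=
  ([ffun i => psi (inl i)], [ffun w => psi (inr w)]).
have splitI : injective split.
  move=> psi psi' [/ffunP e1 /ffunP e2]; apply/ffunP => -[i|w].
    by have := e1 i; rewrite !ffunE.
  by have := e2 w; rewrite !ffunE.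
have le : (num_good col adj setT <= #|V| ^ r * #|D|)%N.
  have -> : (#|V| ^ r = #|[set: {ffun 'I_r -> V}]|)%N by rewrite cardsT card_ffun card_ord.
  rewrite /num_good -(cardsE D) -cardsX.
  rewrite (eq_bigr (fun psi => if good col adj setT psi then 1 else 0)%N); last first.
    by move=> psi _; case: good.
  rewrite -big_mkcond sum1_card -(card_imset _ splitI).
  apply: subset_leq_card; apply/subsetP => _ /imsetP[psi + ->].
  rewrite unfold_in => /goodP g; rewrite !inE /=.
  apply/forallP => a; apply/forallP => c; apply/implyP => ac.
  by rewrite !ffunE; apply: g.
have V0 : 0 < #|V|%:R ^+ r :> R by rewrite exprn_gt0 // ltr0n.
rewrite /N card_ffun card_sum card_ord expnD natrM !natrX => H.
rewrite -(ler_pM2l V0) mulrCA; apply: le_trans H _.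
by rewrite -natrX -natrM ler_nat.
Qed.

End Fixed.

End Supersaturation.


(** * Crossing embeddings in a graph of large minimum degree *)

Lemma min_degree_le (V : finType) (G : sgraph V) v : min_degree G <= degree G v.
Proof.
rewrite /min_degree; have := mem_index_enum v.
elim: (index_enum V) => //= u l IH; rewrite inE big_cons geq_min.
by case/orP => [/eqP->|/IH ->]; rewrite ?leqnn ?orbT.
Qed.

Lemma card_non_neighbours (V : finType) (G : sgraph V) v :
  #|[pred z | [set v; z] \notin edges G]| <= #|V| - min_degree G.
Proof.
have H : min_degree G <= #|[pred z | [set v; z] \in edges G]|.
  apply: leq_trans (min_degree_le G v) _.
  apply: (@leq_trans #|[set [set v; z] | z in [pred z | [set v; z] \in edges G]]|).
    rewrite /degree; apply: subset_leq_card; apply/subsetP => e.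
    rewrite inE => /andP[eG ve].
    have /cards2P[x [y [xy exy]]] : #|e| == 2.
      by have := subsetP (edges_pairs G) _ eG; rewrite inE.
    move: ve; rewrite {1}exy in_set2 => /orP[] /eqP vE; apply/imsetP.
      by exists y; rewrite ?inE vE -?exy.
    by exists x; rewrite ?inE vE setUC -?exy.
  exact: leq_imset_card.
have <- := cardC [pred z | [set v; z] \in edges G].
rewrite leq_subRL; last by rewrite (leq_trans H) ?leq_addr.
by rewrite leq_add2r.
Qed.

(** Union bound over the pairs that collide; a given pair collides in a proportion [1 / #|V|] of all
    maps. *)
Lemma card_noninjective (V W : finType) :
  #|V| * #|[pred phi : {ffun W -> V} | ~~ injectiveb phi]| <=
  #|W| ^ 2 * #|V| ^ #|W|.
Proof.
rewrite -card_ffun.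
apply: (@leq_trans (#|V| * \sum_(a : W) \sum_(b : W | a != b)
    #|[pred phi : {ffun W -> V} | phi a == phi b]|)).
  rewrite leq_mul2l; apply/orP; right; rewrite -sum1_card big_mkcond.
  rewrite (eq_bigr (fun a => \sum_(phi : {ffun W -> V})
     \sum_(b : W | a != b) (phi a == phi b))); last first.
    move=> a _; rewrite exchange_big; apply: eq_bigr => b _ /=.
    rewrite -sum1_card big_mkcond; apply: eq_bigr => phi _.
    by rewrite inE; case: (_ == _).
  rewrite exchange_big; apply: leq_sum => phi _; rewrite inE.
  case: ifP => // /injectivePn[a [b ab e]].
  by rewrite (bigD1 a) //= (bigD1 b) //= e eqxx.
rewrite big_distrr /= -mulnn -mulnA -sum_nat_const; apply: leq_sum => a _.
rewrite big_distrr /= -sum_nat_const.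
rewrite [X in _ <= X](bigID (fun b => a != b)) /=; apply: leq_trans (leq_addr _ _).
by apply: leq_sum => b ab; rewrite card_collision.
Qed.

Section CrossingEmbeddings.
Variables (R : realType) (r : nat) (W : finType) (f : W -> 'I_r) (alpha : R).
Local Open Scope ring_scope.

(** All pairs in different parts must map to edges, as for a complete multipartite graph on [W]. *)
Definition crossing (V : finType) (G : sgraph V) (phi : {ffun W -> V}) :=
  injectiveb phi && [forall a, forall b, (f a != f b) ==> ([set phi a; phi b] \in edges G)].

Lemma num_crossing_embeddings :
  (2 <= r)%N -> (r%:R - 2) / (r%:R - 1) < alpha -> alpha <= 1 ->
  exists2 c : R, 0 < c & exists n0 : nat, forall (V : finType) (G : sgraph V),
    (n0 <= #|V|)%N -> alpha * #|V|%:R <= (min_degree G)%:R ->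
    c * #|V|%:R ^+ #|W| <= #|[pred phi | crossing G phi]|%:R.
Proof.
move=> r2 ralpha alpha1.
have r1 : 0 < r%:R - 1 :> R by rewrite subr_gt0 ltr1n.
(* Any [r - 1] vertices have at least [delta * n] common neighbours; [delta] is positive because
   [alpha] exceeds [(r - 2) / (r - 1)]. *)
pose delta := 1 - (r%:R - 1) * (1 - alpha).
have delta_gt0 : 0 < delta.
  by move: ralpha; rewrite ltr_pdivrMr // /delta => H; lra.
pose c0 := (delta ^+ r) ^+ (2 ^ #|W|).
have c0_gt0 : 0 < c0 by rewrite !exprn_gt0.
exists (c0 / 2); first by rewrite divr_gt0.
(* From this size on, the non-injective maps number at most half of the lower bound
   [c0 * #|V| ^+ #|W|]. *)
pose x : R := 2 * #|W|%:R ^+ 2 / c0.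
have x0 : 0 <= x by rewrite divr_ge0 ?mulr_ge0 ?exprn_ge0 // ltW.
exists (maxn 1 (Num.bound x)) => V G; rewrite geq_max => /andP[V0 Vx] Gdeg.
have xV : x <= #|V|%:R.
  by apply: le_trans (ltW (archi_boundP x0)) _; rewrite ler_nat.
pose adj : rel V := fun u v => [set u; v] \in edges G.
have adj_sym : symmetric adj by move=> u v; rewrite /adj setUC.
have db : delta * #|V|%:R <= #|V|%:R - r.-1%:R * (#|V| - min_degree G)%N%:R.
  have -> : r.-1%:R = r%:R - 1 :> R by rewrite -subn1 natrB // (ltnW r2).
  have : (#|V| - min_degree G)%N%:R <= (1 - alpha) * #|V|%:R.
    have [le|le] := leqP (min_degree G) #|V|.
      by rewrite natrB // mulrBl mul1r lerD2l lerN2.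
    rewrite (eqP (_ : (_ - _ == 0)%N)); last by rewrite subn_eq0 ltnW.
    by rewrite mulr_ge0 // subr_ge0.
  move=> /(ler_wpM2l (ltW r1)) H; rewrite /delta.
  rewrite mulrBl mul1r lerD2l lerN2; apply: le_trans H _.
  by rewrite mulrA.
have := num_crossing_maps f adj_sym (card_non_neighbours G) delta_gt0 db V0.
rewrite -/c0 => H.
set D := [pred phi | crossing G phi].
have leD : (#|[pred phi : {ffun W -> V} |
     [forall a, forall b, (f a != f b) ==> adj (phi a) (phi b)]]| <=
     #|D| + #|[pred phi : {ffun W -> V} | ~~ injectiveb phi]|)%N.
  rewrite -cardUI; apply: leq_trans (leq_addr _ _); apply: subset_leq_card.
  by apply/subsetP => phi; rewrite !inE /crossing => ->; case: injectiveb.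
have N2 : #|[pred phi : {ffun W -> V} | ~~ injectiveb phi]|%:R <=
    c0 / 2 * #|V|%:R ^+ #|W|.
  have VR : 0 < #|V|%:R :> R by rewrite ltr0n.
  rewrite -(ler_pM2l VR) -natrM.
  apply: (@le_trans _ _ (#|W| ^ 2 * #|V| ^ #|W|)%N%:R).
    by rewrite ler_nat card_noninjective.
  rewrite natrM !natrX mulrA ler_wpM2r ?exprn_ge0 //.
  by move: xV; rewrite /x ler_pdivrMr // => ?; lra.
have H' : c0 * #|V|%:R ^+ #|W| <= #|D|%:R +
    #|[pred phi : {ffun W -> V} | ~~ injectiveb phi]|%:R.
  by apply: le_trans H _; rewrite -natrD ler_nat.
lra.
Qed.

End CrossingEmbeddings.

(** * Densities *)


Section Densities.
Variables (R : realType) (W : finType) (H : sgraph W).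
Local Open Scope ring_scope.

Lemma bigmin_attained (I : finType) (F : I -> R) (x : R) :
  \big[Num.min/x]_i F i = x \/ exists i, \big[Num.min/x]_i F i = F i.
Proof.
pose P y := y = x \/ exists i, y = F i.
rewrite -/(P _); apply: (big_ind P) => [|y z Py Pz|i _]; first by left.
- by rewrite /Num.min; case: ifP.
- by right; exists i.
Qed.

Lemma d2_le_m2 (S : {set W}) :
  d2 R #|S| #|[set e in edges H | e \subset S]| <= m2 R H.
Proof.
rewrite /m2; apply: le_trans (le_bigmax _ _ S).
pose F := [set e in edges H | e \subset S].
apply: (@le_bigmax_cond _ _ _ _ F) => //.
apply/andP; split; first by apply/subsetP => e; rewrite inE => /andP[].
by apply/forall_inP => e; rewrite inE => /andP[].
Qed.

End Densities.

Section Partition.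
Variables (R : realType) (r : nat) (W : finType) (H : sgraph W).
Local Open Scope ring_scope.

(** [U] is [S] viewed inside the subtype of [P]; images under [val] match the edges. *)
Lemma d2_le_m2_induced (P S : {set W}) : S \subset P ->
  d2 R #|S| #|[set e in edges H | e \subset S]| <= m2 R (induced_subgraph H P).
Proof.
move=> SP; pose U := [set x : {x : W | x \in P} | val x \in S].
have valU (A : {set W}) : A \subset P ->
    [set val x | x in [set x : {x : W | x \in P} | val x \in A]] = A.
  move=> AP; apply/setP => w; apply/imsetP/idP => [[x + ->]|wA].
    by rewrite inE.
  by exists (exist _ w (subsetP AP _ wA)); rewrite ?inE.
rewrite -{1}(valU S SP) (card_imset _ val_inj).
have -> : #|[set e in edges H | e \subset S]| =
    #|[set e in edges (induced_subgraph H P) | e \subset U]|.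
  rewrite -(card_imset _ (imset_inj val_inj)); apply: eq_card => e.
  apply/idP/imsetP => [|[e' + ->]].
    rewrite inE => /andP[eH eS]; have eP := subset_trans eS SP.
    exists [set x : {x : W | x \in P} | val x \in e]; last by rewrite valU.
    rewrite inE; apply/andP; split; first by rewrite inE valU.
    by apply/subsetP => x; rewrite !inE; exact: (subsetP eS).
  rewrite !inE => /andP[-> e'U] /=; apply/subsetP => _ /imsetP[x xe ->].
  by have := subsetP e'U _ xe; rewrite inE.
exact: d2_le_m2.
Qed.

Lemma m2r_partition : (0 < r)%N ->
  exists f : {ffun W -> 'I_r}, forall i (S : {set W}),
    S \subset [set x | f x == i] ->
    d2 R #|S| #|[set e in edges H | e \subset S]| <= m2r R r H.
Proof.
move=> r0; rewrite /m2r.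
pose F (f : {ffun W -> 'I_r}) : R :=
  \big[Num.max/0]_(i < r) m2 R (induced_subgraph H [set x | f x == i]).
rewrite -/F.
(* If the minimum equals its default [m2 R H], this value bounds all vertex sets, and a single part
   will do. *)
have [->|[f ->]] := bigmin_attained F (m2 R H).
  exists [ffun=> Ordinal r0] => i S _; exact: d2_le_m2.
exists f => i S SP; apply: le_trans (d2_le_m2_induced SP) _.
by rewrite /F; exact: (@le_bigmax _ _ _ _ _ i).
Qed.

End Partition.


(** With [mi] the inverse density, [s - 2] cancels [(e - 1) * mi]. What remains is at least
    [gamma * (e - 1)], hence at least [theta]. *)
Lemma exponent_bound (R : realType) (mi gamma theta e s : R) :
  (0 < theta -> theta <= gamma -> 2 <= e -> (e - 1) * mi <= s - 2 ->
  theta <= s - 2 + ((- mi + gamma) * e - (- mi + gamma)))%R.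
Proof.
move=> t0 tg e2 H.
have : (0 <= gamma * (e - 2))%R by rewrite mulr_ge0 ?subr_ge0 // (le_trans (ltW t0)).
by move=> H'; lra.
Qed.

(** * Lower bounds for [psi] on vertex sets *)

Section Spread.
Variables (R : realType) (r : nat) (W : finType) (H : sgraph W) (f : W -> 'I_r).
Variables (m x p gamma theta : R).
Implicit Types S T : {set W}.
Local Open Scope ring_scope.

Definition part i : {set W} := [set w | f w == i].
Definition inner_edges : {set {set W}} :=
  [set e in edges H | [exists i, e \subset part i]].
Let e0 := edges_in inner_edges.
Let psi (T : {set W}) : R := x ^+ #|T| * p ^+ e0 T.

Lemma inner_pairs : inner_edges \subset pairs W.
Proof.
apply/subsetP => e; rewrite inE => /andP[eH _].
exact: (subsetP (edges_pairs H)).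
Qed.

Lemma card_inner e : e \in inner_edges -> #|e| = 2%N.
Proof. by move=> /(subsetP inner_pairs); rewrite inE => /eqP. Qed.

Hypothesis d2m : forall i (S : {set W}), S \subset part i ->
  d2 R #|S| #|[set e in edges H | e \subset S]| <= m.
Hypotheses (m0 : 0 < m) (x1 : 1 <= x) (p0 : 0 < p) (p1 : p <= 1).
Hypotheses (theta0 : 0 < theta) (theta1 : theta <= 1) (thetag : theta <= gamma).
Hypothesis xp : x `^ (- m^-1 + gamma) <= p.

Let x0 : 0 < x. Proof. exact: lt_le_trans x1. Qed.
Let eta := x `^ theta.
Let eta0 : 0 < eta. Proof. by rewrite powR_gt0. Qed.
Let x_ge0 : 0 <= x. Proof. exact: ltW. Qed.
Let p_ge0 : 0 <= p. Proof. exact: ltW. Qed.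
Let eta_ge0 : 0 <= eta. Proof. exact: ltW. Qed.
Let eta_x : eta <= x.
Proof. by rewrite -[X in _ <= X](powRr1 (ltW x0)) ler_powR. Qed.
Let eta1 : 1 <= eta.
Proof. by rewrite -(powRr0 x) ler_powR // ltW. Qed.

Lemma e0_part i S : S \subset part i -> e0 S = #|[set e in edges H | e \subset S]|.
Proof.
move=> SP; apply: eq_card => e; rewrite !inE -andbA; congr (_ && _).
case: (boolP (e \subset S)) => eS; rewrite ?andbF // andbT.
by apply/existsP; exists i; apply: subset_trans SP.
Qed.

(** Dividing [psi S] by the value [x ^+ 2 * p] of a single edge leaves the exponents [|S| - 2] and
    [e - 1] that appear in the 2-density. *)
Lemma spread_core i S : S \subset part i -> (2 < #|S|)%N -> (0 < e0 S)%N ->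
  eta <= x ^+ (#|S| - 2) * p ^+ (e0 S - 1).
Proof.
move=> SP S3 e1; have := d2m SP; rewrite -(e0_part SP) /d2 S3.
have s0 : 0 < #|S|%:R - 2 :> R by rewrite subr_gt0 ltr_nat.
rewrite ler_pdivrMr // => He.
have xe : x ^+ (#|S| - 2) = x `^ (#|S|%:R - 2).
  by rewrite -powR_mulrn // natrB // ltnW.
have [e2|e2] := leqP (e0 S) 1.
  have -> : (e0 S - 1 = 0)%N by apply/eqP; rewrite subn_eq0.
  rewrite mulr1; apply: le_trans eta_x _.
  by rewrite -[X in X <= _]expr1 ler_weXn2l // subn_gt0.
have pe : x `^ ((- m^-1 + gamma) * (e0 S)%:R - (- m^-1 + gamma)) <= p ^+ (e0 S - 1).
  have -> : (- m^-1 + gamma) * (e0 S)%:R - (- m^-1 + gamma) =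
      (- m^-1 + gamma) * (e0 S - 1)%:R by rewrite natrB // mulrBr mulr1.
  rewrite powRrM powR_mulrn ?powR_ge0 //.
  by rewrite lerXn2r ?nnegrE ?powR_ge0 // ltW.
apply: le_trans (_ : x `^ (#|S|%:R - 2) *
  x `^ ((- m^-1 + gamma) * (e0 S)%:R - (- m^-1 + gamma)) <= _); last first.
  by rewrite xe ler_wpM2l ?powR_ge0.
rewrite -powRD; last by apply/implyP => _; rewrite gt_eqF.
rewrite ler_powR //.
have e2' : 2 <= (e0 S)%:R :> R by rewrite ler_nat.
have He' : ((e0 S)%:R - 1) * m^-1 <= #|S|%:R - 2.
  by rewrite ler_pdivrMr // mulrC.
exact: exponent_bound.
Qed.

(** An edge inside a part forces [m >= 1] by the convention for a single edge, so [p] is at least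
    [x] to the power [gamma - 1]. *)
Lemma spread_edge i S : S \subset part i -> (0 < e0 S)%N -> eta <= x * p.
Proof.
move=> SP; rewrite card_gt0 => /set0Pn[e]; rewrite inE => /andP[eE eS].
have eP := subset_trans eS SP.
have m1 : 1 <= m.
  apply: le_trans (d2m eP); rewrite (card_inner eE) /d2 /= ler1n card_gt0.
  apply/set0Pn; exists e; rewrite inE subxx andbT.
  by move: eE; rewrite inE => /andP[].
apply: (@le_trans _ _ (x * x `^ (- m^-1 + gamma))); last by rewrite ler_pM2l.
rewrite -{1}(powRr1 (ltW x0)) -powRD; last by apply/implyP => _; rewrite gt_eqF.
rewrite ler_powR // addrA (le_trans thetag) // lerDr.
by rewrite subr_ge0 invf_le1.
Qed.

Lemma e0_small S : (#|S| < 2)%N -> e0 S = 0%N.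
Proof.
move=> S2; apply/eqP; rewrite cards_eq0; apply/eqP/setP => e; rewrite !inE.
apply/negP => /andP[eE /subset_leq_card]; rewrite card_inner ?inE // => S2'.
by move: S2; rewrite ltnNge S2'.
Qed.

Let x_le k l : (k <= l)%N -> x ^+ k <= x ^+ l.
Proof. by move=> kl; rewrite ler_weXn2l. Qed.

Let psi_edge S : (1 < #|S|)%N -> (0 < e0 S)%N ->
  psi S = (x ^+ 2 * p) * (x ^+ (#|S| - 2) * p ^+ (e0 S - 1)).
Proof.
move=> S2 e1; by rewrite /psi -{1}(subnKC S2) -{1}(subnKC e1) !exprD expr1 mulrACA.
Qed.

Lemma spread_part2 i S : S \subset part i -> (1 < #|S|)%N ->
  x ^+ 2 * p <= psi S /\ x * eta <= psi S.
Proof.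
move=> SP S2; have xx : x * eta <= x ^+ 2 by rewrite expr2 ler_pM2l.
have [e0S|e1] := posnP (e0 S).
  have xS : x ^+ 2 <= psi S by rewrite /psi e0S mulr1 x_le.
  split; last exact: le_trans xx xS.
  by apply: le_trans xS; rewrite ler_piMr // exprn_ge0 // ltW.
have H2 : x ^+ 2 * p <= psi S.
  have xxp : 0 <= x ^+ 2 * p by rewrite mulr_ge0 ?exprn_ge0.
  rewrite psi_edge // ler_peMr //.
  (* Two vertices span at most one edge, so the remaining factor is 1. *)
  have [S3|S3] := leqP #|S| 2.
    have -> : (#|S| - 2 = 0)%N by apply/eqP; rewrite subn_eq0.
    have e1' : (e0 S <= 1)%N.
      rewrite (e0_part SP).
      apply: (@leq_trans #|[set S]|); last by rewrite cards1.
      apply: subset_leq_card; apply/subsetP => e; rewrite !inE => /andP[eH eS].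
      rewrite eqEcard eS; have := subsetP (edges_pairs H) _ eH.
      by rewrite inE => /eqP ->.
    have -> : (e0 S - 1 = 0)%N by apply/eqP; rewrite subn_eq0.
    by rewrite !expr0 mulr1.
  exact: le_trans eta1 (spread_core SP S3 e1).
split=> //; apply: le_trans H2; rewrite expr2 -mulrA ler_pM2l //.
exact: (spread_edge SP e1).
Qed.

Lemma spread_part3 i S : S \subset part i -> (2 < #|S|)%N ->
  x ^+ 2 * p * eta <= psi S.
Proof.
move=> SP S3; have [e0S|e1] := posnP (e0 S).
  rewrite /psi e0S mulr1; apply: le_trans (x_le S3).
  rewrite [X in _ <= X]exprSr; apply: ler_pM => //; rewrite ?mulr_ge0 ?exprn_ge0 //.
  by rewrite ger_pMr // exprn_gt0.
rewrite psi_edge ?(ltnW S3) // ler_pM2l ?mulr_gt0 ?exprn_gt0 //.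
exact: spread_core SP S3 e1.
Qed.

(** An inner edge lies in one part, so it is inside part [i] or disjoint from it. *)
Lemma spread_split i T : psi (T :&: part i) * psi (T :\: part i) <= psi T.
Proof.
have e0T : (e0 T <= e0 (T :&: part i) + e0 (T :\: part i))%N.
  rewrite /e0 /edges_in.
  apply: leq_trans (leq_card_setU _ _); apply: subset_leq_card.
  apply/subsetP => e; rewrite in_set => /andP[eE eT].
  have := eE; rewrite inE => /andP[_ /existsP[j ej]].
  rewrite in_setU 2!in_set eE /=.
  have [ij|ij] := eqVneq i j; apply/orP; [left|right].
    by rewrite subsetI eT ij.
  rewrite subsetD eT; apply/pred0P => w; rewrite /= inE.
  apply/negP => /andP[/(subsetP ej)]; rewrite inE => /eqP ->.
  by rewrite eq_sym (negbTE ij).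
rewrite /psi -(cardsID (part i) T) exprD mulrACA -exprD -exprD.
rewrite ler_wpM2l ?exprn_ge0 // ler_wiXn2l // ltW.
Qed.

Lemma card_setD_part i T k : (#|T :&: part i| + k <= #|T|)%N ->
  (k <= #|T :\: part i|)%N.
Proof. by rewrite -(cardsID (part i) T) leq_add2l. Qed.

Let psi_ge0 T : 0 <= psi T.
Proof. by rewrite mulr_ge0 ?exprn_ge0 // ltW. Qed.

Lemma spread_part1 i S : S \subset part i -> S != set0 -> x <= psi S.
Proof.
move=> SP; rewrite -card_gt0 => S1; have [S2|S2] := leqP #|S| 1.
  by rewrite /psi e0_small // mulr1 -[X in X <= _]expr1 x_le.
have [_] := spread_part2 SP S2; apply: le_trans.
by rewrite ler_peMr // ltW.
Qed.

(** Peels off one part at a time by [spread_split]. *)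
Lemma spread_ge1 T : 1 <= psi T.
Proof.
have [k] := ubnP #|T|; elim: k T => // k IH T Tk.
have [->|/set0Pn[a aT]] := eqVneq T set0.
  by rewrite /psi e0_small ?cards0 // mulr1.
apply: le_trans (spread_split (f a) T).
have Sa : a \in T :&: part (f a) by rewrite !inE aT eqxx.
rewrite -[1]mulr1; apply: ler_pM => //.
  apply: le_trans x1 (spread_part1 (subsetIr _ _) _).
  by apply/set0Pn; exists a.
apply: IH; apply: leq_trans _ (Tk : (#|T| <= k)%N).
rewrite -(cardsID (part (f a)) T) -add1n leq_add2r card_gt0.
by apply/set0Pn; exists a.
Qed.

Lemma spread_gex T : T != set0 -> x <= psi T.
Proof.
case/set0Pn => a aT; apply: le_trans (spread_split (f a) T).
rewrite -[X in X <= _]mulr1; apply: ler_pM; rewrite ?spread_ge1 //.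
apply: (spread_part1 (subsetIr _ _)).
by apply/set0Pn; exists a; rewrite !inE aT eqxx.
Qed.

Lemma spread_nonempty T : T != set0 -> eta <= psi T.
Proof. by move=> T0; apply: le_trans eta_x (spread_gex T0). Qed.

Lemma spread_two T : (1 < #|T|)%N -> x * eta <= psi T.
Proof.
move=> T2; have /set0Pn[a aT] : T != set0 by rewrite -card_gt0 ltnW.
apply: le_trans (spread_split (f a) T).
have [S2|S2] := leqP #|T :&: part (f a)| 1; last first.
  have [_ H2] := spread_part2 (subsetIr _ _) S2.
  rewrite -[X in X <= _]mulr1; apply: ler_pM; rewrite ?spread_ge1 //.
  by rewrite mulr_ge0 ?ltW.
apply: ler_pM => //.
  apply: spread_gex; by apply/set0Pn; exists a; rewrite !inE aT eqxx.
apply: spread_nonempty; rewrite -card_gt0; apply: card_setD_part.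
by rewrite addn1; apply: leq_ltn_trans S2 T2.
Qed.

(** If the part holds only two vertices of [T], it yields [x ^+ 2 * p], and a vertex elsewhere
    yields [eta]. Otherwise [spread_part3] yields both. *)
Lemma spread_same T a b : (2 < #|T|)%N -> a \in T -> b \in T -> a != b ->
  f a = f b -> x ^+ 2 * p * eta <= psi T.
Proof.
move=> T3 aT bT ab fab; apply: le_trans (spread_split (f a) T).
have S2 : (1 < #|T :&: part (f a)|)%N.
  apply: (@leq_trans #|[set a; b]|); first by rewrite cards2 ab.
  by apply: subset_leq_card; apply/subsetP => c; rewrite !inE =>
    /orP[] /eqP ->; rewrite ?aT ?bT ?fab eqxx.
have [S3|S3] := leqP #|T :&: part (f a)| 2; last first.
  rewrite -[X in X <= _]mulr1; apply: ler_pM; rewrite ?spread_ge1 //.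
    by rewrite !mulr_ge0 ?exprn_ge0 ?ltW.
  exact: (spread_part3 (subsetIr _ _) S3).
have [H2 _] := spread_part2 (subsetIr _ _) S2.
apply: ler_pM => //; rewrite ?mulr_ge0 ?exprn_ge0 //.
apply: spread_nonempty; rewrite -card_gt0; apply: card_setD_part.
by rewrite addn1; apply: leq_ltn_trans S3 T3.
Qed.

(** The part of [a] splits [T] into two nonempty pieces. One has at least two vertices and yields
    [x * eta]; the other yields [x]. *)
Lemma spread_cross T a b : (2 < #|T|)%N -> a \in T -> b \in T ->
  f a != f b -> x ^+ 2 * eta <= psi T.
Proof.
move=> T3 aT bT fab; apply: le_trans (spread_split (f a) T).
have Sa : T :&: part (f a) != set0.
  by apply/set0Pn; exists a; rewrite !inE aT eqxx.
have Sb : T :\: part (f a) != set0.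
  by apply/set0Pn; exists b; rewrite !inE bT eq_sym fab.
have [S2|S2] := leqP #|T :&: part (f a)| 1.
  rewrite expr2 -mulrA; apply: ler_pM; rewrite ?mulr_ge0 //.
    exact: spread_gex.
  apply: spread_two; apply: card_setD_part.
  by apply: leq_trans T3; rewrite -(leq_add2r 2) in S2.
have -> : x ^+ 2 * eta = (x * eta) * x by rewrite expr2 mulrAC.
have [_ H2] := spread_part2 (subsetIr _ _) S2.
apply: ler_pM; rewrite ?mulr_ge0 //; exact: spread_gex.
Qed.

End Spread.

(** * The game on the union *)


Lemma card_pairs_le (V : finType) : #|pairs V| <= #|V| ^ 2.
Proof.
rewrite -mulnn -card_prod.
apply: leq_trans (leq_imset_card (fun u : V * V => [set u.1; u.2]) predT).
apply: subset_leq_card; apply/subsetP => e; rewrite inE => /cards2P[x [y [_ ->]]].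
by apply/imsetP; exists (x, y).
Qed.

Section Deterministic.
Variables (R : realType) (r : nat) (W V : finType) (H : sgraph W).
Variables (f : W -> 'I_r) (G Gam : sgraph V) (mf : bool).
Local Open Scope ring_scope.

Let E0 := inner_edges H f.
Let X := edges (graph_union G Gam).
Let alive : pred {ffun W -> V} :=
  fun phi => crossing f G phi && (img E0 phi \subset edges Gam).
Let s := #|edges H|.

Lemma inner_or_cross e : e \in edges H ->
  e \in E0 \/ exists a b, [/\ e = [set a; b], a != b & f a != f b].
Proof.
move=> eH; have /cards2P[a [b [ab eE]]] : #|e| == 2.
  by have := subsetP (edges_pairs H) _ eH; rewrite inE.
have [fab|fab] := eqVneq (f a) (f b); last by right; exists a, b.
left; rewrite inE eH; apply/existsP; exists (f a); rewrite eE.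
by apply/subsetP => w; rewrite !inE => /orP[] /eqP ->; rewrite ?fab.
Qed.

Lemma alive_board phi : alive phi -> img (edges H) phi \subset X.
Proof.
move=> /andP[/andP[_ cr] phiG]; apply/subsetP => _ /imsetP[e eH ->].
rewrite /X /= inE; have [eE|[a [b [-> _ fab]]]] := inner_or_cross eH.
  by rewrite (subsetP phiG) ?orbT //; apply: imset_f.
rewrite imsetU1 imset_set1.
by have /forallP/(_ a)/forallP/(_ b)/implyP -> := cr.
Qed.

Lemma alive_inj phi : alive phi -> injective phi.
Proof. by move=> /andP[/andP[/injectiveP]]. Qed.

(* Up to constants and powers of [h], the number of rounds in which Maker's and
   Breaker's edges can play the roles [e] and [e'] in a copy; the diagonal case
   stands for Breaker's opening move. *)
Definition role_scale (x p : R) (e e' : {set W}) : R :=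
  if e == e' then 1 else
  if (e \in E0) || (e' \in E0) then x ^+ 2 * p else x ^+ 2.

Variables (x p h Phi : R).
Hypotheses (x0 : 0 < x) (p0 : 0 < p) (h1 : 1 <= h) (Phi0 : 0 <= Phi).
Hypothesis Vx : #|V|%:R <= x.
Hypothesis rootedP : forall e e', e \in edges H -> e' \in edges H ->
  forall phi : {ffun W -> V},
  (rooted E0 [set phi w | w in e :|: e'] (e :|: e') Gam)%:R <=
    Phi / (role_scale x p e e' * h ^+ 2).
Hypothesis cardGam : #|edges Gam|%:R <= x ^+ 2 * p * h.
Hypothesis survP : 2 ^+ s * (s%:R ^+ 2 * (3 * (Phi / h))) <
  (surviving E0 (crossing f G) Gam)%:R.

Let h0 : 0 < h. Proof. exact: lt_le_trans h1. Qed.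

(** Two edges play at most [s ^ 2] pairs of roles. For fixed roles all copies send [e :|: e'] onto
    the same vertex set, so [rooted] counts them with any one copy as reference. *)
Lemma codeg_roles (y y' : {set V}) (B : R) : 0 <= B ->
  (forall phi e e', alive phi -> e \in edges H -> e' \in edges H ->
     [set phi w | w in e] = y -> [set phi w | w in e'] = y' ->
     Phi / (role_scale x p e e' * h ^+ 2) <= B) ->
  (codeg alive (img (edges H)) y y')%:R <= s%:R ^+ 2 * B.
Proof.
move=> B0 HB.
pose Q (e e' : {set W}) := [pred phi : {ffun W -> V} | [&& alive phi,
  [set phi w | w in e] == y & [set phi w | w in e'] == y']].
have le1 : (codeg alive (img (edges H)) y y' <=
    \sum_(e in edges H) \sum_(e' in edges H) #|Q e e'|)%N.
  rewrite /codeg -sum1_card big_mkcond /=.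
  under [X in (_ <= X)%N]eq_bigr => e _ do
    (under eq_bigr => e' _ do rewrite -sum1_card big_mkcond /=;
     rewrite exchange_big /=).
  rewrite exchange_big /=; apply: leq_sum => phi _; rewrite !inE.
  case: ifP => // /and3P[al /imsetP[e eH ey] /imsetP[e' e'H ey']].
  rewrite (bigD1 e) //= (bigD1 e') //= -addnA inE al -ey -ey' !eqxx.
  by rewrite leq_addr.
apply: (@le_trans _ _ (\sum_(e in edges H) \sum_(e' in edges H) #|Q e e'|)%N%:R).
  by rewrite ler_nat.
rewrite natr_sum expr2 -mulrA mulr_natl -sumr_const; apply: ler_sum => e eH.
rewrite natr_sum mulr_natl -sumr_const; apply: ler_sum => e' e'H.
have [/card0_eq Q0|] := posnP #|Q e e'|; first by rewrite (eq_card0 Q0).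
move=> /card_gt0P[phi]; rewrite inE => /and3P[al /eqP ey /eqP ey'].
apply: le_trans (HB phi e e' al eH e'H ey ey').
apply: le_trans (rootedP eH e'H phi); rewrite ler_nat /rooted.
apply: subset_leq_card; apply/subsetP => psi; rewrite !inE.
move=> /and3P[al' /eqP ey1 /eqP ey1'].
have /andP[/andP[-> _] ->] := al'.
by rewrite !imsetU ey ey' ey1 ey1' subxx.
Qed.

Lemma maker_wins_of_spread : maker_wins mf H (graph_union G Gam).
Proof.
(* Up to the factor [s ^ 2], codegrees are bounded by [Kd] for two crossing roles, [Ks] if a role is
   inner, and [K1] for a single edge. Every edge is charged [Kd]; edges of [Gam] also pay [Ks],
   since inner roles are played only by them. *)
pose Kd := Phi / (x ^+ 2 * h ^+ 2).
pose Ks := Phi / (x ^+ 2 * p * h ^+ 2).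
pose K1 := Phi / h ^+ 2.
have Kd0 : 0 <= Kd by rewrite divr_ge0 // mulr_ge0 ?exprn_ge0 // ltW.
have Ks0 : 0 <= Ks by rewrite divr_ge0 // !mulr_ge0 ?exprn_ge0 // ltW.
have K10 : 0 <= K1 by rewrite divr_ge0 // exprn_ge0 // ltW.
pose gk (z : {set V}) : R := Kd + (if z \in edges Gam then Ks else 0).
have gk0 z : 0 <= gk z by rewrite addr_ge0 //; case: ifP.
have Ksy z : z \in edges Gam -> Ks <= gk z by rewrite /gk => ->; rewrite lerDr.
have Kdy z : Kd <= gk z by rewrite lerDl; case: ifP.
pose g (z : {set V}) : R := s%:R ^+ 2 * gk z.
(* At most [x ^+ 2] edges pay [Kd], and at most [x ^+ 2 * p * h] pay [Ks]. *)
have sumg : \sum_(z in X) gk z <= Phi / h + Phi / h.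
  rewrite big_split /=; apply: lerD.
    rewrite sumr_const -mulr_natl.
    apply: (@le_trans _ _ (x ^+ 2 * Kd)).
      rewrite ler_wpM2r //; apply: (@le_trans _ _ (#|V| ^ 2)%N%:R).
        rewrite ler_nat; apply: leq_trans (card_pairs_le V).
        exact: subset_leq_card (edges_pairs _).
      by rewrite natrX lerXn2r // nnegrE // ltW.
    have -> : x ^+ 2 * Kd = Phi / h / h.
      rewrite /Kd; move: x0 h0 => xx hh; field.
      by rewrite !gt_eqF.
    by rewrite ler_pdivrMr // ler_peMr // divr_ge0 // ltW.
  rewrite -big_mkcondr /=; apply: (@le_trans _ _ (\sum_(z in edges Gam) Ks)).
    rewrite [X in _ <= X](bigID (mem X)) /= addrC.
    rewrite (eq_bigl (fun z => (z \in edges Gam) && (z \in X))); last first.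
      by move=> z; rewrite andbC.
    by rewrite lerDr; apply: sumr_ge0.
  rewrite sumr_const -mulr_natl.
  apply: (@le_trans _ _ (x ^+ 2 * p * h * Ks)); first by rewrite ler_wpM2r.
  rewrite le_eqVlt; apply/orP; left; apply/eqP.
  rewrite /Ks; move: x0 h0 p0 => xx hh pp; field.
  by rewrite !gt_eqF.
have As : forall i : {ffun W -> V}, alive i -> (#|img (edges H) i| <= s)%N.
  by move=> i _; exact: leq_imset_card.
have K1h : K1 <= Phi / h.
  rewrite ler_wpM2l // lef_pV2 ?posrE ?exprn_gt0 //.
  by rewrite expr2 ler_peMr // ltW.
have g0 z : z \in X -> 0 <= g z by move=> _; rewrite mulr_ge0 ?exprn_ge0.
have D0 : 0 <= s%:R ^+ 2 * K1 by rewrite mulr_ge0 ?exprn_ge0.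
have degP y : y \in X -> (codeg alive (img (edges H)) y y)%:R <= s%:R ^+ 2 * K1.
  move=> _; apply: codeg_roles => // phi e e' al _ _ <- ee.
  have /(imset_inj (alive_inj al)) <- := ee.
  by rewrite /role_scale eqxx mul1r.
have codegP y y' : y \in X -> y' \in X -> y != y' ->
    (codeg alive (img (edges H)) y y')%:R <= g y + g y'.
  move=> _ _ yy'; rewrite /g -mulrDr; apply: codeg_roles; first by rewrite addr_ge0.
  move=> phi e e' /andP[_ al] _ _ ey ey'; rewrite /role_scale.
  case: eqP => [ee|_]; first by rewrite -ey -ey' ee eqxx in yy'.
  case: ifP => [/orP[eE|eE]|_].
  - have yG : y \in edges Gam by rewrite -ey (subsetP al) //; apply: imset_f.
    by apply: le_trans (Ksy _ yG) _; rewrite lerDl.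
  - have yG : y' \in edges Gam by rewrite -ey' (subsetP al) //; apply: imset_f.
    by apply: le_trans (Ksy _ yG) _; rewrite lerDr.
  - by apply: le_trans (Kdy y) _; rewrite lerDl.
(* The 3 in [survP] covers the two sums of charges and Breaker's opening move. *)
have big : 2 ^+ s * (\sum_(z in X) g z + s%:R ^+ 2 * K1) <
    #|[pred phi | alive phi]|%:R.
  apply: le_lt_trans survP; rewrite ler_wpM2l ?exprn_ge0 //.
  rewrite /g -big_distrr /= -mulrDr ler_wpM2l ?exprn_ge0 //.
  by apply: le_trans (lerD sumg K1h) _; move: (Phi / h) => z; have -> : 3 * z = z + z + z by ring.
exists (greedy alive (img (edges H)) X mf); first exact: greedy_legal.
move=> sB sBl.
have [phi al sub] := greedy_wins mf As alive_board D0 g0 degP codegP big sBl.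
exists phi; split; first exact: alive_inj al.
by move=> e eH; apply: (subsetP sub); apply: imset_f.
Qed.

End Deterministic.

(** * Probability of success *)


Section ExtensionBound.
Variables (R : realType) (W V : finType) (E0 : {set {set W}}) (p : R).
Local Open Scope ring_scope.
Hypothesis p0 : 0 <= p.
Let x : R := #|V|%:R.

(** The product of the term of [S] with [x ^+ #|S| * p ^+ edges_in E0 S] is [u ^ #|S|] times
    [x ^+ #|W| * p ^+ #|E0|]. *)
Lemma ext_count_bound (u : nat) (T : {set W}) (M : R) : (0 < u)%N -> 0 <= M ->
  (forall S : {set W}, T \subset S -> M <= x ^+ #|S| * p ^+ edges_in E0 S) ->
  ext_count V E0 p u T * M <=
    #|{set W}|%:R * u%:R ^+ #|W| * (x ^+ #|W| * p ^+ #|E0|).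
Proof.
move=> u0 M0 HM; have x0 : 0 <= x by rewrite /x.
rewrite /ext_count big_distrl /=.
have -> : #|{set W}|%:R * u%:R ^+ #|W| * (x ^+ #|W| * p ^+ #|E0|) =
    \sum_(S : {set W}) u%:R ^+ #|W| * (x ^+ #|W| * p ^+ #|E0|).
  by rewrite sumr_const -mulrA mulr_natl.
rewrite [X in _ <= X](bigID (fun S : {set W} => T \subset S)) /=.
rewrite -[X in X <= _]addr0 lerD //; last first.
  by apply: sumr_ge0 => S _; rewrite !mulr_ge0 ?exprn_ge0.
apply: ler_sum => S TS.
have SW : (#|S| <= #|W|)%N by exact: max_card.
have SE : (edges_in E0 S <= #|E0|)%N.
  by apply: subset_leq_card; apply/subsetP => e; rewrite inE => /andP[].
rewrite -!mulrA; apply: ler_pM => //.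
- by rewrite !mulr_ge0 ?exprn_ge0.
- by rewrite -natrX ler_nat leq_pexp2l.
rewrite -[in X in _ <= X](subnK SW) -[in X in _ <= X](subnK SE) !exprD.
rewrite mulrACA mulrA ler_wpM2l ?mulr_ge0 ?exprn_ge0 //; exact: HM.
Qed.

Lemma Ex_card_edges : (0 <= p <= 1) ->
  Ex p (fun Gam : sgraph V => #|edges Gam|%:R) <= x ^+ 2 * p.
Proof.
move=> p01; have -> : Ex p (fun Gam : sgraph V => #|edges Gam|%:R) =
    Ex p (fun Gam => \sum_(e in pairs V) ([set e] \subset edges Gam)%:R).
  apply: eq_bigr => Gam _; congr (_ * _).
  rewrite -sum1_card natr_sum big_mkcond [RHS]big_mkcond.
  apply: eq_bigr => e _ /=; rewrite sub1set.
  by case: ifP => eG; [rewrite (subsetP (edges_pairs Gam) _ eG)|case: ifP].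
rewrite Ex_sum (eq_bigr (fun=> p)) => [|e eV]; last first.
  by rewrite Ex_sub ?sub1set // cards1 expr1.
rewrite sumr_const -mulr_natl ler_wpM2r // -natrX ler_nat.
exact: card_pairs_le.
Qed.

End ExtensionBound.

Section WithHighProbability.
Variables (R : realType) (r : nat) (W V : finType) (H : sgraph W).
Variables (f : W -> 'I_r) (G : sgraph V) (mf : bool) (p h c : R) (q : nat).
Local Open Scope ring_scope.

Let E0 := inner_edges H f.
Let s := #|edges H|.
Let x : R := #|V|%:R.
Let Phi : R := x ^+ #|W| * p ^+ #|E0|.

(** The base bounds the number of roots plus the vertices of [q] exposed maps; the successor keeps
    it positive. *)
Definition ext_const : R := #|{set W}|%:R * (#|W| + q * #|W|).+1%:R ^+ #|W|.
(** The terms belong to the moments of rooted counts, the number of random edges and the deviation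
    of the number of copies. *)
Definition fail_const : R :=
  s%:R ^+ 2 * ext_const ^+ q + 1 + 4 * s%:R * ext_const / c.
(** Once [h] exceeds this, [c * Phi / 2] copies outweigh the total charge. *)
Definition size_const : R := 2 ^+ s * (s%:R ^+ 2 * 3) * 2 / c.

Hypotheses (V0 : (0 < #|V|)%N) (p0 : 0 < p) (p1 : p <= 1) (h1 : 1 <= h).
Hypotheses (c0 : 0 < c) (q0 : (0 < q)%N).
Hypothesis spread : forall e e', e \in edges H -> e' \in edges H ->
  forall S : {set W}, e :|: e' \subset S ->
  role_scale H f x p e e' * h ^+ 4 <= x ^+ #|S| * p ^+ edges_in E0 S.
Hypothesis crossings :
  c * x ^+ #|W| <= #|[pred phi : {ffun W -> V} | crossing f G phi]|%:R.
Hypothesis xq : x ^+ #|W| <= h ^+ q.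
Hypothesis hbig : size_const < h.

Let p01 : 0 <= p <= 1. Proof. by rewrite ltW. Qed.
Let x0 : 0 < x. Proof. by rewrite ltr0n. Qed.
Let h0 : 0 < h. Proof. exact: lt_le_trans h1. Qed.
Let Phi0 : 0 < Phi. Proof. by rewrite mulr_gt0 ?exprn_gt0. Qed.
Let h_ge0 : 0 <= h. Proof. exact: ltW. Qed.
Let c_ge0 : 0 <= c. Proof. exact: ltW. Qed.
Let p_ge0 : 0 <= p. Proof. exact: ltW. Qed.
Let Phi_ge0 : 0 <= Phi. Proof. exact: ltW. Qed.
Let E0W : E0 \subset pairs W. Proof. exact: inner_pairs. Qed.
Let ext_const_ge0 : 0 <= ext_const.
Proof. by rewrite mulr_ge0 ?exprn_ge0. Qed.
Let u := (#|W| + q * #|W|).+1.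

Lemma role_scale_gt0 e e' : 0 < role_scale H f x p e e'.
Proof. by rewrite /role_scale; case: ifP => // _; case: ifP => _; rewrite ?mulr_gt0 ?exprn_gt0. Qed.

Let K e e' := Phi / (role_scale H f x p e e' * h ^+ 2).
Let K_gt0 e e' : 0 < K e e'.
Proof. by rewrite divr_gt0 // mulr_gt0 ?exprn_gt0 ?role_scale_gt0. Qed.

Lemma ext_count_role e e' : e \in edges H -> e' \in edges H ->
  ext_count V E0 p u (e :|: e') * (role_scale H f x p e e' * h ^+ 4) <=
    ext_const * Phi.
Proof.
move=> eH e'H; apply: ext_count_bound => //.
  by rewrite mulr_ge0 ?exprn_ge0 // ltW // role_scale_gt0.
exact: spread.
Qed.

(** Of the four powers of [h] in [spread], two are spent in [K] and two remain as gain. *)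
Lemma Ex_rooted e e' (phi : {ffun W -> V}) : e \in edges H -> e' \in edges H ->
  Ex p (fun Gam => ((rooted E0 [set phi w | w in e :|: e'] (e :|: e') Gam)%:R
     / K e e') ^+ q) <= (ext_const / h ^+ 2) ^+ q.
Proof.
move=> eH e'H; set T := e :|: e'; set Q := [set phi w | w in T].
have -> : Ex p (fun Gam => ((rooted E0 Q T Gam)%:R / K e e') ^+ q) =
    (K e e')^-1 ^+ q * Ex p (fun Gam => (set0 \subset edges Gam)%:R *
       (rooted E0 Q T Gam)%:R ^+ q).
  rewrite -ExZ; apply: eq_bigr => Gam _; congr (_ * _).
  by rewrite sub0set mul1r exprMn mulrC.
have Qu : (#|Q| + q * #|W| <= u)%N.
  rewrite /u -addSn leq_add2r; apply: leqW.
  by apply: leq_trans (leq_imset_card _ _) _; exact: max_card.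
have C0 : {in set0, forall d : {set V}, d \subset Q} by move=> d; rewrite inE.
have := moment_rooted E0W p01 T (sub0set (pairs V)) C0 (subxx Q) Qu.
rewrite cards0 expr0 mul1r => HM.
apply: (@le_trans _ _ ((K e e')^-1 ^+ q * ext_count V E0 p u T ^+ q)).
  by rewrite ler_wpM2l // exprn_ge0 // invr_ge0 ltW.
rewrite -exprMn; apply: lerXn2r; rewrite ?nnegrE.
- by rewrite mulr_ge0 ?invr_ge0 ?ext_count_ge0 // ltW.
- by rewrite divr_ge0 ?exprn_ge0 // ltW.
have rs0 := role_scale_gt0 e e'.
rewrite mulrC ler_pdivrMr //.
have -> : ext_const / h ^+ 2 * K e e' =
    ext_const * Phi / (role_scale H f x p e e' * h ^+ 4).
  rewrite /K; move: (role_scale _ _ _ _ _ _) rs0 Phi ext_const => a a0 F C.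
  by field; rewrite !gt_eqF.
by rewrite ler_pdivlMr ?ext_count_role // mulr_gt0 ?exprn_gt0.
Qed.

(** This is why high moments are taken: the [x ^+ #|W|] choices of [phi] cost at most [h ^+ q],
    against a gain of [h ^+ (2 * q)]. *)
Lemma Ex_rooted_sum :
  Ex p (fun Gam => \sum_(e in edges H) \sum_(e' in edges H)
     \sum_(phi : {ffun W -> V})
       ((rooted E0 [set phi w | w in e :|: e'] (e :|: e') Gam)%:R / K e e') ^+ q)
    <= s%:R ^+ 2 * ext_const ^+ q / h.
Proof.
rewrite Ex_sum; apply: (@le_trans _ _ (\sum_(e in edges H) \sum_(e' in edges H)
    \sum_(phi : {ffun W -> V}) (ext_const / h ^+ 2) ^+ q)).
  apply: ler_sum => e eH; rewrite Ex_sum; apply: ler_sum => e' e'H.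
  by rewrite Ex_sum; apply: ler_sum => phi _; exact: Ex_rooted.
rewrite !sumr_const card_ffun -/s -[X in X <= _]mulr_natl -[X in _ * X <= _]mulr_natl.
rewrite mulrA -expr2 -[X in _ * X <= _]mulr_natl -[X in _ <= X]mulrA.
rewrite ler_wpM2l ?exprn_ge0 // natrX -/x exprMn mulrCA ler_wpM2l ?exprn_ge0 //.
apply: (@le_trans _ _ (h ^+ q * (h ^+ 2)^-1 ^+ q)).
  by rewrite ler_wpM2r // exprn_ge0 // invr_ge0 exprn_ge0 // ltW.
rewrite exprVn -exprM mulnC exprM expr2 invfM mulrA divff ?mul1r; last first.
  by rewrite gt_eqF // exprn_gt0.
rewrite lef_pV2 ?posrE ?exprn_gt0 //.
by rewrite -[X in X <= _]expr1 ler_weXn2l.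
Qed.

Let D := [pred phi : {ffun W -> V} | crossing f G phi].
Let mu : R := #|D|%:R * p ^+ #|E0|.

Let mu_Phi : c * Phi <= mu.
Proof. by rewrite /mu /Phi mulrA ler_wpM2r // exprn_ge0 // ltW. Qed.
Let mu0 : 0 < mu.
Proof. by apply: lt_le_trans mu_Phi; rewrite mulr_gt0. Qed.

(** Chebyshev's normalisation: a deviation of [mu / 2] gives the value 1. The variance is controlled
    by [spread] with [e = e']. *)
Lemma Ex_deviation :
  Ex p (fun Gam => 4 / mu ^+ 2 * ((surviving E0 (crossing f G) Gam)%:R - mu) ^+ 2)
    <= 4 * s%:R * ext_const / c / h.
Proof.
rewrite ExZ.
have D_inj (phi : {ffun W -> V}) : crossing f G phi -> injective phi.
  by move=> /andP[/injectiveP].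
apply: (@le_trans _ _ (4 / mu ^+ 2 * (mu * \sum_(e in E0) ext_count V E0 p #|W| e))).
  by rewrite ler_wpM2l ?variance_surviving // divr_ge0 // exprn_ge0 // ltW.
have -> (z : R) : 4 / mu ^+ 2 * (mu * z) = 4 * (z / mu).
  by move: mu mu0 => m m0; field; rewrite gt_eqF.
have -> : 4 * s%:R * ext_const / c / h = 4 * (s%:R * (ext_const * (c^-1 * h^-1))).
  by rewrite !mulrA.
rewrite ler_wpM2l //.
have le1 : \sum_(e in E0) ext_count V E0 p #|W| e <= s%:R * (ext_const * Phi / h).
  rewrite mulr_natl; apply: (@le_trans _ _ (\sum_(e in E0) ext_const * Phi / h)).
    apply: ler_sum => e eE; have eH : e \in edges H.
      by move: eE; rewrite inE => /andP[].
    apply: le_trans (ext_count_le V E0 p01 e (_ : #|W| <= u)%N) _.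
      by rewrite /u leqW // leq_addr.
    have := ext_count_role eH eH; rewrite setUid /role_scale eqxx mul1r => HH.
    rewrite ler_pdivlMr //; apply: le_trans HH.
    rewrite ler_wpM2l ?ext_count_ge0 //.
    by rewrite -[X in X <= _]expr1 ler_weXn2l.
  rewrite sumr_const ler_wpMn2l //.
    exact: divr_ge0 (mulr_ge0 ext_const_ge0 Phi_ge0) h_ge0.
  by apply: subset_leq_card; apply/subsetP => e; rewrite inE => /andP[].
rewrite ler_pdivrMr //; apply: le_trans le1 _.
apply: (@le_trans _ _ (s%:R * (ext_const * (c^-1 * h^-1)) * (c * Phi))).
  rewrite le_eqVlt; apply/orP; left; apply/eqP.
  by move: Phi ext_const => F C; field; rewrite !gt_eqF.
have ch : 0 <= c^-1 * h^-1 by rewrite mulr_ge0 ?invr_ge0.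
rewrite ler_wpM2l //; exact: mulr_ge0 (ler0n _ _) (mulr_ge0 ext_const_ge0 ch).
Qed.

(** A single Markov bound for a sum of three nonnegative variables: if it is below 1, each summand
    is, and all conditions of [maker_wins_of_spread] hold at once. *)
Lemma maker_wins_whp :
  1 - fail_const / h <= gnp_pr p (fun Gam => maker_wins mf H (graph_union G Gam)).
Proof.
pose Y1 Gam := \sum_(e in edges H) \sum_(e' in edges H)
     \sum_(phi : {ffun W -> V})
       ((rooted E0 [set phi w | w in e :|: e'] (e :|: e') Gam)%:R / K e e') ^+ q.
pose Y2 (Gam : sgraph V) : R := (x ^+ 2 * p * h)^-1 * #|edges Gam|%:R.
pose Y3 Gam := 4 / mu ^+ 2 * ((surviving E0 (crossing f G) Gam)%:R - mu) ^+ 2.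
have xph : 0 < x ^+ 2 * p * h by rewrite !mulr_gt0 ?exprn_gt0.
have term0 e e' (phi : {ffun W -> V}) Gam : 0 <=
   ((rooted E0 [set phi w | w in e :|: e'] (e :|: e') Gam)%:R / K e e') ^+ q.
  by rewrite exprn_ge0 // divr_ge0 // ltW.
have Y1_0 Gam : 0 <= Y1 Gam by do 3!apply: sumr_ge0 => ? _.
have Y2_0 Gam : 0 <= Y2 Gam by rewrite mulr_ge0 // invr_ge0 ltW.
have Y3_0 Gam : 0 <= Y3 Gam.
  by rewrite mulr_ge0 ?divr_ge0 ?sqr_ge0.
apply: le_trans (markov_gnp p01 (Y := fun Gam => Y1 Gam + Y2 Gam + Y3 Gam) _ _).
- rewrite lerD2l lerN2 !ExD /fail_const [X in _ <= X]mulrDl [X in _ <= X + _]mulrDl.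
  apply: lerD; last exact: Ex_deviation.
  apply: lerD; first exact: Ex_rooted_sum.
  rewrite ExZ mul1r mulrC ler_pdivrMr //.
  apply: le_trans (Ex_card_edges V (ltW p0) p01) _.
  by rewrite [X in _ <= X]mulrC mulfK // gt_eqF.
- by move=> Gam; rewrite !addr_ge0.
move=> Gam Ylt.
have lt1 : Y1 Gam < 1 by apply: le_lt_trans Ylt; rewrite -addrA lerDl addr_ge0.
have lt2 : Y2 Gam < 1 by apply: le_lt_trans Ylt; rewrite addrAC lerDr addr_ge0.
have lt3 : Y3 Gam < 1 by apply: le_lt_trans Ylt; rewrite lerDr addr_ge0.
apply: (@maker_wins_of_spread R r W V H f G Gam mf x p h Phi) => //.
- move=> e e' eH e'H phi.
  rewrite -[X in _ <= X]mul1r -/(K e e') -ler_pdivrMr //.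
  rewrite leNgt; apply/negP => z1; move: lt1; rewrite ltNge => /negP[].
  apply: le_trans (exprn_ege1 q (ltW z1)) _.
  rewrite /Y1 (bigD1 e) //= (bigD1 e') //= (bigD1 phi) //= -!addrA lerDl.
  apply: addr_ge0; first exact: sumr_ge0.
  by apply: addr_ge0; do ![apply: sumr_ge0 => ? _].
- by move: (ltW lt2); rewrite /Y2 mulrC ler_pdivrMr // mul1r.
apply: (@lt_le_trans _ _ (c * Phi / 2)).
  move: hbig; rewrite /size_const ltr_pdivrMr // => hb.
  rewrite ltr_pdivlMr // -(ltr_pM2r h0).
  have -> : 2 ^+ s * (s%:R ^+ 2 * (3 * (Phi / h))) * 2 * h =
     2 ^+ s * (s%:R ^+ 2 * 3) * 2 * Phi.
    by move: (2 ^+ s : R) (s%:R ^+ 2 : R) Phi => a b F; field; rewrite gt_eqF.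
  by rewrite (mulrAC c) (mulrC c h) ltr_pM2r.
rewrite leNgt; apply/negP => slt.
have half : mu / 2 <= mu - (surviving E0 (crossing f G) Gam)%:R.
  rewrite lerBrDr -lerBrDl; apply: le_trans (ltW slt) _.
  have -> : mu - mu / 2 = mu / 2 by move: mu => m; field.
  by rewrite ler_pM2r ?invr_gt0.
move: lt3; rewrite ltNge => /negP[]; rewrite /Y3 -(opprB mu) sqrrN.
apply: (@le_trans _ _ (4 / mu ^+ 2 * (mu / 2) ^+ 2)).
  rewrite le_eqVlt; apply/orP; left; apply/eqP.
  by move: mu mu0 => m m0; field; rewrite gt_eqF.
rewrite ler_wpM2l ?divr_ge0 ?exprn_ge0 ?(ltW mu0) //.
have mu2 : 0 <= mu / 2 by rewrite divr_ge0 ?(ltW mu0).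
by rewrite lerXn2r // nnegrE // (le_trans mu2).
Qed.

End WithHighProbability.

(** * Asymptotics *)


Section RoleSpread.
Variables (R : realType) (r : nat) (W : finType) (H : sgraph W) (f : W -> 'I_r).
Variables (m x p gamma theta : R).
Local Open Scope ring_scope.
Hypothesis d2m : forall i (S : {set W}), S \subset part f i ->
  d2 R #|S| #|[set e in edges H | e \subset S]| <= m.
Hypotheses (m0 : 0 < m) (x1 : 1 <= x) (p0 : 0 < p) (p1 : p <= 1).
Hypotheses (theta0 : 0 < theta) (theta1 : theta <= 1) (thetag : theta <= gamma).
Hypothesis xp : x `^ (- m^-1 + gamma) <= p.

Lemma card_edge e : e \in edges H -> #|e| = 2%N.
Proof. by move=> /(subsetP (edges_pairs H)); rewrite inE => /eqP. Qed.

Lemma card_edgeU e e' : e \in edges H -> e' \in edges H -> e != e' ->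
  (2 < #|e :|: e'|)%N.
Proof.
move=> eH e'H ne; rewrite -(card_edge eH); apply: proper_card.
rewrite properE subsetUl /=; apply: contra ne => /subsetP sub.
rewrite eq_sym eqEcard card_edge // card_edge // leqnn andbT.
by apply/subsetP => w we; apply: sub; rewrite inE we orbT.
Qed.

Lemma inner_edgeP e : e \in inner_edges H f ->
  exists a b, [/\ a \in e, b \in e, a != b & f a = f b].
Proof.
rewrite inE => /andP[eH /existsP[i ei]].
have /cards2P[a [b [ab eE]]] : #|e| == 2 by rewrite card_edge.
have ae : a \in e by rewrite eE !inE eqxx.
have be : b \in e by rewrite eE !inE eqxx orbT.
exists a, b; split => //.
by have := subsetP ei _ ae; have := subsetP ei _ be; rewrite !inE => /eqP-> /eqP->.
Qed.

(** Distinct edges span at least three vertices. An inner edge supplies two ends in one part; if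
    neither is inner, [e] supplies ends in different parts. *)
Lemma role_spread e e' (S : {set W}) : e \in edges H -> e' \in edges H ->
  e :|: e' \subset S ->
  role_scale H f x p e e' * x `^ theta <=
    x ^+ #|S| * p ^+ edges_in (inner_edges H f) S.
Proof.
move=> eH e'H; rewrite subUset => /andP[eS e'S]; rewrite /role_scale.
case: eqVneq => [_|ne].
  rewrite mul1r; apply: (spread_nonempty d2m m0 x1 p0 p1 theta0 theta1 thetag xp).
  by rewrite -card_gt0; apply: leq_trans (subset_leq_card eS); rewrite card_edge.
have S3 : (2 < #|S|)%N.
  apply: leq_trans (card_edgeU eH e'H ne) _; apply: subset_leq_card.
  by rewrite subUset eS.
case: ifP => [|/norP[eE _]].
  case/orP => /inner_edgeP[a [b [ae be ab fab]]].
    exact: (spread_same d2m m0 x1 p0 p1 theta0 theta1 thetag xp S3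
              (subsetP eS _ ae) (subsetP eS _ be) ab fab).
  exact: (spread_same d2m m0 x1 p0 p1 theta0 theta1 thetag xp S3
            (subsetP e'S _ ae) (subsetP e'S _ be) ab fab).
have [eI|[a [b [eab _ fab]]]] := inner_or_cross f eH.
  by rewrite eI in eE.
apply: (spread_cross d2m m0 x1 p0 p1 theta0 theta1 thetag xp S3 _ _ fab).
  by apply: (subsetP eS); rewrite eab !inE eqxx.
by apply: (subsetP eS); rewrite eab !inE eqxx orbT.
Qed.

End RoleSpread.

Lemma powR_unbounded (R : realType) (t M : R) : (0 < t -> 0 < M ->
  exists N : nat, forall n, (N <= n)%N -> M < n%:R `^ t)%R.
Proof.
move=> t0 M0; exists (Num.bound (M `^ t^-1)%R) => n Nn.
have lt : (M `^ t^-1 < n%:R)%R.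
  by apply: lt_le_trans (archi_boundP (powR_ge0 _ _)) _; rewrite ler_nat.
have MM : M = ((M `^ t^-1) `^ t)%R.
  by rewrite -powRrM mulVf ?powRr1 ?(ltW M0) // gt_eqF.
rewrite MM.
by apply: gt0_ltr_powR; rewrite ?nnegrE ?powR_ge0.
Qed.

From mathcomp Require Import all_boot all_order all_algebra.
From mathcomp Require Import all_classical all_reals all_analysis.
Import Order.TTheory GRing.Theory Num.Theory.
Import numFieldNormedType.Exports.
Local Open Scope ring_scope.

Theorem theorem1p5 (R : realType) (gamma : R) (r : nat) (alpha : R)
    (W : finType) (H : sgraph W)
    (G : forall n : nat, sgraph 'I_n) (p : nat -> R) (maker_first : bool) :
  0 < gamma ->
  (2 <= r)%N ->
  (r%:R - 2) / (r%:R - 1) < alpha <= (r%:R - 1) / r%:R ->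
  0 < m2r R r H ->
  (forall n : nat, 0 <= p n <= 1) ->
  (\forall n \near \oo%classic, alpha * n%:R <= (min_degree (G n))%:R) ->
  (\forall n \near \oo%classic, n%:R `^ (- (m2r R r H)^-1 + gamma) <= p n) ->
  aas p (fun n Gnp => maker_wins maker_first H (graph_union (G n) Gnp)).
Proof.
move=> gamma0 r2 /andP[alpha_lo alpha_hi] m0 p01 Gdeg plo.
have r0 : (0 < r)%N by exact: ltnW.
have [f d2m] := m2r_partition R H r0.
have alpha1 : alpha <= 1.
  apply: le_trans alpha_hi _; rewrite ler_pdivrMr ?ltr0n // mul1r.
  by rewrite lerBlDr lerDl.
have [c c0 [n0 crossings]] := num_crossing_embeddings f r2 alpha_lo alpha1.
(* Capped at 1 because the spread bounds need [x ^ theta] to be at most [x]. *)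
pose theta := Num.min gamma 1.
have theta0 : 0 < theta by rewrite lt_min gamma0 ltr01.
have theta1 : theta <= 1 by rewrite ge_min lexx orbT.
have thetag : theta <= gamma by rewrite ge_min lexx.
(* With [h] equal to [n] to the power [t], the fourth power of [h] in [spread] is exactly [n] to the
   power [theta]. *)
pose t := theta / 4.
have t0 : 0 < t by rewrite divr_gt0.
(* Chosen so that [n ^ #|W|] is at most [h ^ q]; the successor makes [q] positive. *)
pose q := (Num.bound (#|W|%:R / t)).+1.
have wq : #|W|%:R <= t * q%:R.
  rewrite mulrC -ler_pdivrMr //; apply: le_trans (ltW (archi_boundP _)) _.
    by rewrite divr_ge0 // ltW.
  by rewrite ler_nat.
pose C := fail_const H c q.
have whp n : (0 < n)%N -> (n0 <= n)%N -> size_const H c < n%:R `^ t ->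
    alpha * n%:R <= (min_degree (G n))%:R ->
    n%:R `^ (- (m2r R r H)^-1 + gamma) <= p n ->
  1 - C / n%:R `^ t <= gnp_pr (p n)
    (fun Gnp => maker_wins maker_first H (graph_union (G n) Gnp)).
  move=> n_gt0 n0n hbig deg pn.
  have x1 : 1 <= n%:R :> R by rewrite ler1n.
  have x0 : 0 < n%:R :> R by rewrite ltr0n.
  have /andP[_ p1] := p01 n.
  have p0 : 0 < p n by apply: lt_le_trans pn; rewrite powR_gt0.
  apply: (@maker_wins_whp R r W 'I_n H f (G n) maker_first (p n) _ c q);
    rewrite ?card_ord //.
  - by rewrite -[X in X <= _](powRr0 n%:R) ler_powR // ltW.
  - move=> e e' eH e'H S sub.
    have -> : (n%:R `^ t) ^+ 4 = n%:R `^ theta.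
      by rewrite -powR_mulrn ?powR_ge0 // -powRrM /t divfK.
    exact: role_spread d2m m0 x1 p0 p1 theta0 theta1 thetag pn _ _ _ eH e'H sub.
  - by have := crossings 'I_n (G n); rewrite card_ord; apply.
  - by rewrite -!powR_mulrn ?powR_ge0 // -powRrM ler_powR.
(* The maximum with 1 supplies the positive threshold required by [powR_unbounded]. *)
have max1_gt0 (z : R) : 0 < Num.max 1 z by rewrite lt_max ltr01.
apply/cvgrPdist_lt => eps eps0.
have [N1 HN1] := powR_unbounded t0 (max1_gt0 (size_const H c)).
have [N2 HN2] := powR_unbounded t0 (max1_gt0 (C / eps)).
near=> n.
have h1 : Num.max 1 (size_const H c) < n%:R `^ t.
  by apply: HN1; near: n; exact: nbhs_infty_ge.
have h2 : Num.max 1 (C / eps) < n%:R `^ t.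
  by apply: HN2; near: n; exact: nbhs_infty_ge.
have h0 : 0 < n%:R `^ t by apply: lt_trans h2.
rewrite ger0_norm ?subr_ge0 ?gnp_pr_le1 //.
have n_gt0 : (0 < n)%N by near: n; exact: nbhs_infty_gt.
have n0n : (n0 <= n)%N by near: n; exact: nbhs_infty_ge.
apply: (@le_lt_trans _ _ (C / n%:R `^ t)).
  rewrite lerBlDr addrC -lerBlDr; apply: whp => //.
  - by move: h1; rewrite gt_max => /andP[].
  - by near: n.
  - by near: n.
by move: h2; rewrite gt_max => /andP[_]; rewrite ltr_pdivrMr // mulrC -ltr_pdivrMr.
Unshelve. all: by end_near.
Qed.
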